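(* Let $\alpha,\beta\in\{0,1\}$. There is a constant $C>0$, independent of $N\ge1$, such that for all $u_h\in V_{h,N}^{(0,0)}$, $$\|\partial_xI_N^{(0,0)}u_h\|_{(\alpha,\beta)}\le C\,\|\partial_xu_h\|_{(\alpha,\beta)} ,$$ i.e. the Gauss--Lobatto interpolation operator $I_N^{(0,0)}:V_{h,N}^{(0,0)}\to\mathbb{P}^N$ is stable in the $(\alpha,\beta)$-weighted $H^1$-seminorm.
   Context: $\|v\|_{(\alpha,\beta)}^2=\int_{-1}^1v(x)^2(1-x)^\alpha(1+x)^\beta\,dx$. $\mathbb{P}^N$: univariate polynomials of degree at most $N$. $-1=\xi_0<\dots<\xi_N=1$ are the $N+1$ Gauss--Lobatto points (roots of $(1-x^2)P_N'(x)$, $P_N$ the Legendre polynomial). $V_{h,N}^{(0,0)}$ is the space of continuous functions on $[-1,1]$ that are piecewise linear with respect to the points $\xi_i$. $I_N^{(0,0)}u\in\mathbb{P}^N$ is the Lagrange interpolant defined by $(I_N^{(0,0)}u)(\xi_i)=u(\xi_i)$, $0\le i\le N$. *)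

(* Defs.v *)
From HB Require Import structures.
From mathcomp Require Import all_boot all_order all_algebra.
From mathcomp Require Import all_classical all_reals all_analysis.

Set Implicit Arguments.
Unset Strict Implicit.
Unset Printing Implicit Defensive.

Import Order.TTheory GRing.Theory Num.Theory.
Import numFieldNormedType.Exports.

Local Open Scope classical_set_scope.
Local Open Scope ring_scope.

(* Rodrigues' formula. *)
Definition legendre (R : realType) (n : nat) : {poly R} :=
  ((2 ^ n * n`!)%:R)^-1 *: derivn n (('X^2 - 1) ^+ n).

(* For 0 < N exactly one xi satisfies this, for N = 0 none does. *)
Definition gauss_lobatto (R : realType) (N : nat) (xi : 'I_N.+1 -> R) : Prop :=
  [/\ xi ord0 = -1,
      xi ord_max = 1,
      (forall i j : 'I_N.+1, (i < j)%N -> xi i < xi j)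
    & forall x : R,
        root ((1 - 'X^2) * deriv (legendre R N)) x <-> exists i, xi i = x].

(* Functions on [-1, 1] are represented by functions on R whose values outside
   [-1, 1] are irrelevant. *)
Definition piecewise_linear (R : realType) (N : nat) (xi : 'I_N.+1 -> R)
    (u : R -> R) : Prop :=
  {within `[-1, 1], continuous u} /\
  forall i j : 'I_N.+1, j = i.+1 :> nat ->
    exists a b : R, forall x : R, xi i <= x <= xi j -> u x = a * x + b.

Definition lagrange_interp (R : realType) (N : nat) (xi : 'I_N.+1 -> R)
    (u : R -> R) : {poly R} :=
  \sum_(i < N.+1)
    u (xi i) *: \prod_(j < N.+1 | j != i)
                  ((xi i - xi j)^-1 *: ('X - (xi j)%:P)).

(* The integrand is nonnegative on [-1, 1]. The integral is the real part of an
   extended real one, so this is the weighted L^2 norm only for those v for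
   which that integral is finite. *)
Definition weighted_norm (R : realType) (alpha beta : nat) (v : R -> R) : R :=
  Num.sqrt (\int[lebesgue_measure]_(x in `[-1, 1])
              (v x ^+ 2 * (1 - x) ^+ alpha * (1 + x) ^+ beta)).

(* [derive1 v] takes an arbitrary value where v is not differentiable; for v
   piecewise linear or polynomial on [-1, 1] this concerns finitely many points
   of the interval, which do not contribute to the integral. *)
Definition weighted_H1_seminorm (R : realType) (alpha beta : nat)
    (v : R -> R) : R :=
  weighted_norm alpha beta (derive1 v).

Lemma lagrange_interp_node (R : realType) (N : nat) (xi : 'I_N.+1 -> R)
    (u : R -> R) (i : 'I_N.+1) :
  injective xi -> (lagrange_interp xi u).[xi i] = u (xi i).
Proof.
move=> xi_inj; rewrite /lagrange_interp horner_sum (bigD1 i) //=.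
rewrite [X in _ + X]big1 => [|k ki]; last first.
  rewrite hornerZ horner_prod (bigD1 i) 1?eq_sym //=.
  by rewrite hornerZ hornerXsubC subrr mulr0 mul0r mulr0.
rewrite addr0 hornerZ horner_prod big1 ?mulr1 // => j ji.
by rewrite hornerZ hornerXsubC mulVf // subr_eq0 (inj_eq xi_inj) eq_sym.
Qed.

Lemma size_lagrange_interp (R : realType) (N : nat) (xi : 'I_N.+1 -> R)
    (u : R -> R) : (size (lagrange_interp xi u) <= N.+1)%N.
Proof.
apply: (leq_trans (size_sum _ _ _)); apply/bigmax_leqP => i _.
apply: (leq_trans (size_scale_leq _ _)); rewrite scaler_prod.
apply: (leq_trans (size_scale_leq _ _)).
rewrite size_prod => [|j _]; last by rewrite polyXsubC_eq0.
rewrite (eq_bigr (fun=> 2%N)) => [|j _]; last by rewrite size_XsubC.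
by rewrite sum_nat_const cardC1 card_ord /= muln2 -addnn -addSn addnK.
Qed.

Lemma lagrange_interp_unique (R : realType) (N : nat) (xi : 'I_N.+1 -> R)
    (u : R -> R) (p : {poly R}) :
  injective xi -> (size p <= N.+1)%N -> (forall i, p.[xi i] = u (xi i)) ->
  p = lagrange_interp xi u.
Proof.
move=> xi_inj sp pu; apply/eqP; rewrite -subr_eq0; apply/eqP.
apply: (@roots_geq_poly_eq0 _ _ (codom xi)).
- apply/allP => _ /codomP[i ->].
  by rewrite rootE hornerD hornerN pu lagrange_interp_node // subrr.
- by rewrite map_inj_uniq // enum_uniq.
- rewrite size_codom card_ord (leq_trans (size_polyD _ _)) // size_polyN.
  by rewrite geq_max sp size_lagrange_interp.
Qed.

(* Main.v *)
(* Write u for the piecewise linear function, z for a polynomial of degree at most N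
   and v = u - z. The interpolant of u is z + I v, so it suffices to choose z close
   to u and stable, and to bound I v by an inverse inequality.

   Let w = (1 - x)^alpha (1 + x)^beta and b = (1 - x)^(1 - alpha) (1 + x)^(1 - beta),
   so that w b = 1 - x^2. After subtracting an affine function, u vanishes at the
   zeros of b. The operator p |-> - (w (b p)')' is symmetric for the weight b and
   triangular in the degree, hence diagonal on the polynomials e_k orthogonal for b,
   with eigenvalues of size k^2. This gives at once the inverse inequality
   int w ((b p)')^2 <= C N^2 int b p^2 for b p of degree at most N, and, z being the
   expansion of u in b e_0, b e_1, ... truncated at degree N, both
   int w z'^2 <= int w u'^2 (Bessel) and int v^2 / b <= C N^-2 int w u'^2 (the density
   of polynomials, by Bernstein, removes the remainder).

   Since Gauss-Lobatto quadrature is exact up to degree 2 N - 1, it remains to bound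
   N^2 sum_i omega_i v(xi_i)^2 / b(xi_i). Near an interior node xi_i, on an interval of
   length comparable to sqrt(1 - xi_i^2) / N inside the next cell, b and w hardly vary
   and a trace inequality applies; it needs omega_i <= C sqrt(1 - xi_i^2) / N and a lower
   bound of the same kind on the gaps between nodes. As omega_i P_N(xi_i)^2 is constant,
   both follow from the monotonicity of Sonin's functions of Legendre's equation. At
   an endpoint, where the interval has length of order N^-2, one uses instead that u'
   is constant on the cell and that int z'^2 <= C N^2 int (1 - x^2) z'^2. *)

From HB Require Import structures.
From mathcomp Require Import all_boot all_order all_algebra.
From mathcomp Require Import polyrcf ring lra zify.

Set Implicit Arguments.
Unset Strict Implicit.
Unset Printing Implicit Defensive.

Import Order.TTheory GRing.Theory Num.Theory.

Local Open Scope ring_scope.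

(** * Integration of polynomials *)

Definition hornE :=
  (horner_exp, hornerD, hornerN, hornerM, hornerZ, hornerC, hornerX).

Lemma size_deriv_leq (R : nzRingType) (p : {poly R}) n :
  (size p <= n.+1)%N -> (size p^`() <= n)%N.
Proof. by move=> sp; apply: leq_trans (size_poly _ _) _; case: size sp. Qed.

Lemma size_deriv (R : numDomainType) (p : {poly R}) : size p^`() = (size p).-1.
Proof.
have [sp|sp] := leqP (size p) 1; last first.
  have p1 : ((size p).-2.+1 = (size p).-1)%N by rewrite prednK// -subn1 subn_gt0.
  rewrite /deriv size_poly_eq// p1 mulrn_eq0 -lead_coefE lead_coef_eq0 -p1 /=.
  by rewrite -size_poly_gt0 (ltnW sp).
by rewrite (size1_polyC sp) derivC size_poly0 size_polyC; case: eqP.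
Qed.

Section PolyIntegral.
Variable R : rcfType.
Implicit Types (p q v : {poly R}) (a b c x : R).

(** At [i = 0] the coefficient is a division by zero, hence 0 by convention: this is the primitive
    that vanishes at 0. *)
Definition primitive p : {poly R} := \poly_(i < (size p).+1) (p`_i.-1 / i%:R).

Lemma coef_primitive p i : (primitive p)`_i = p`_i.-1 / i%:R.
Proof.
rewrite coef_poly; case: ltnP => // ip; rewrite nth_default ?mul0r//.
by case: i ip => // i; rewrite ltnS.
Qed.

Lemma primitive_is_linear : linear primitive.
Proof.
move=> k p q; apply/polyP => i.
by rewrite !(coefD, coefZ, coef_primitive) mulrDl mulrA.
Qed.
HB.instance Definition _ :=
  GRing.isLinear.Build R {poly R} {poly R} _ primitive primitive_is_linear.

Lemma deriv_primitive p : (primitive p)^`() = p.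
Proof.
apply/polyP => i; rewrite coef_deriv coef_primitive /= -[LHS]mulr_natr divfK//.
by rewrite pnatr_eq0.
Qed.

Lemma deriv_eq0 p : p^`() = 0 -> p = (p`_0)%:P.
Proof.
move=> dp; apply/polyP => -[|i]; rewrite coefC//=.
have := congr1 (fun r : {poly R} => r`_i) dp; rewrite coef_deriv coef0.
by move=> /eqP; rewrite mulrn_eq0 /= => /eqP.
Qed.

(* A formal integral suffices: all the functions that have to be integrated are
   piecewise polynomial. *)
Definition pint a b p := (primitive p).[b] - (primitive p).[a].

Lemma pint_is_linear a b : linear_for *%R (pint a b).
Proof. by move=> k p q; rewrite /pint linearP/= !hornerD !hornerZ; ring. Qed.
HB.instance Definition _ a b :=
  GRing.isLinear.Build R {poly R} R _ (pint a b) (pint_is_linear a b).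

Lemma pintD a b p q : pint a b (p + q) = pint a b p + pint a b q.
Proof. exact: linearD. Qed.

Lemma pintB a b p q : pint a b (p - q) = pint a b p - pint a b q.
Proof. exact: linearB. Qed.

Lemma pintZ a b k p : pint a b (k *: p) = k * pint a b p.
Proof. exact: linearZ. Qed.

Lemma pint_deriv a b p : pint a b p^`() = p.[b] - p.[a].
Proof.
have /deriv_eq0 : (primitive p^`() - p)^`() = 0.
  by rewrite derivB deriv_primitive subrr.
move=> /eqP; rewrite subr_eq => /eqP E.
by rewrite /pint E !hornerE; ring.
Qed.

Lemma pint_parts a b p q :
  pint a b (p^`() * q) = p.[b] * q.[b] - p.[a] * q.[a] - pint a b (p * q^`()).
Proof.
have := pint_deriv a b (p * q); rewrite derivM linearD/= !hornerM => <-.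
by rewrite addrK.
Qed.

Lemma pint_cat c a b p : pint a b p = pint a c p + pint c b p.
Proof. by rewrite /pint; ring. Qed.

Lemma pintC a b k : pint a b k%:P = k * (b - a).
Proof.
have -> : k%:P = (k *: 'X)^`() :> {poly R} by rewrite derivZ derivX alg_polyC.
by rewrite pint_deriv !hornerE; ring.
Qed.

Lemma pintX a b : pint a b 'X = (b ^+ 2 - a ^+ 2) / 2.
Proof.
have -> : 'X = (2^-1 *: 'X^2)^`() :> {poly R}.
  by rewrite derivZ derivXn expr1 -scaler_nat scalerA mulVf ?scale1r// pnatr_eq0.
by rewrite pint_deriv !hornE mulrBl !(mulrC 2^-1).
Qed.

Lemma poly_homo p a b : a <= b -> (forall x, a <= x <= b -> 0 <= p^`().[x]) ->
  p.[a] <= p.[b].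
Proof.
rewrite le_eqVlt => /predU1P[-> //|ab] dp.
have [c cab E] := poly_mvt p ab; rewrite -subr_ge0 E.
by rewrite mulr_ge0 ?subr_ge0 ?(ltW ab)// dp// !ltW ?(itvP cab).
Qed.

Lemma pint_ge0 p a b : a <= b -> (forall x, a <= x <= b -> 0 <= p.[x]) ->
  0 <= pint a b p.
Proof.
by move=> ab p0; rewrite subr_ge0 poly_homo// => x; rewrite deriv_primitive; exact: p0.
Qed.

Lemma le_pint p q a b : a <= b -> (forall x, a <= x <= b -> p.[x] <= q.[x]) ->
  pint a b p <= pint a b q.
Proof.
move=> ab pq; rewrite -subr_ge0 -linearB pint_ge0// => x xab.
by rewrite !hornerE subr_ge0 pq.
Qed.

Lemma pint_itvS p a b a' b' : a <= a' -> a' <= b' -> b' <= b ->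
  (forall x, a <= x <= b -> 0 <= p.[x]) -> pint a' b' p <= pint a b p.
Proof.
move=> aa ab bb p0; rewrite (pint_cat a' a b) (pint_cat b' a' b) addrCA lerDl.
by apply: addr_ge0; apply: pint_ge0 => // x /andP[xa xb]; apply: p0; lra.
Qed.

(** Equally spaced points of the interval provide [size p] distinct roots, one too many for a
    nonzero polynomial. *)
Lemma eq0_poly_itv p a b : a < b -> (forall x, a <= x <= b -> p.[x] = 0) -> p = 0.
Proof.
move=> ab p0; apply/eqP; apply: contraT => pn0.
pose s := [seq a + (b - a) * (i%:R / (size p)%:R) | i <- iota 0 (size p)].
have sp : (0 < size p)%N by rewrite size_poly_gt0.
have sp0 : 0 < (size p)%:R :> R by rewrite ltr0n.
suff : (size s < size p)%N by rewrite size_map size_iota ltnn.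
apply: max_poly_roots => //.
  apply/allP => _ /mapP[i + ->]; rewrite mem_iota => /andP[_ ip].
  apply/rootP/p0.
  have i1 : 0 <= i%:R / (size p)%:R :> R by rewrite divr_ge0.
  have i2 : i%:R / (size p)%:R <= 1 :> R by rewrite ler_pdivrMr// mul1r ler_nat ltnW.
  by nra.
rewrite map_inj_uniq ?iota_uniq// => i j /addrI/mulfI E.
have /E/divIf : b - a != 0 by rewrite subr_eq0 gt_eqF.
by move=> /(_ (lt0r_neq0 sp0)) /eqP; rewrite eqr_nat => /eqP.
Qed.

(** The primitive is monotone with equal values at both ends, hence constant. *)
Lemma pint_eq0 p a b : a < b -> (forall x, a <= x <= b -> 0 <= p.[x]) ->
  pint a b p = 0 -> p = 0.
Proof.
move=> ab p0 pi0.
suff : primitive p - (primitive p).[a]%:P = 0.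
  by move=> /eqP; rewrite subr_eq0 => /eqP E; rewrite -(deriv_primitive p) E derivC.
apply: (eq0_poly_itv ab) => x /andP[ax xb].
apply/eqP; rewrite eq_le !hornerE pint_ge0//; last first.
  by move=> y /andP[ya yx]; apply: p0; rewrite ya (le_trans yx).
by rewrite andbT -[_ - _]/(pint a x p) -pi0 pint_itvS.
Qed.

(** Expand the nonnegative integral of [(p - k)^2], where [k] is the mean of [p]. *)
Lemma pint_cauchy_schwarz p a b : a <= b ->
  pint a b p ^+ 2 <= (b - a) * pint a b (p ^+ 2).
Proof.
rewrite le_eqVlt => /predU1P[<-|ab]; first by rewrite /pint !subrr expr0n mul0r.
pose k := pint a b p / (b - a).
have ab0 : 0 < b - a by rewrite subr_gt0.
have : 0 <= pint a b ((p - k%:P) ^+ 2).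
  by apply: pint_ge0 => [|x _]; [exact: ltW | rewrite horner_exp sqr_ge0].
have -> : (p - k%:P) ^+ 2 = p ^+ 2 - (2 * k) *: p + (k ^+ 2)%:P.
  by rewrite -mul_polyC !(polyCM, polyC_exp) -/(2%:R) polyCMn; ring.
rewrite linearD linearB linearZ/= pintC.
have -> : pint a b p = k * (b - a) by rewrite /k divfK ?gt_eqF.
nra.
Qed.

(** Integrate [v(c)^2 <= 2 v(y)^2 + 2 (v(c) - v(y))^2] over [y]; the last square is bounded by the
    Cauchy-Schwarz inequality for [v'] between [y] and [c]. *)
Lemma poly_trace v a b c : a <= c <= b ->
  (b - a) * v.[c] ^+ 2 <=
  2 * pint a b (v ^+ 2) + 2 * (b - a) ^+ 2 * pint a b (v^`() ^+ 2).
Proof.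
move=> /andP[ac cb]; have ab := le_trans ac cb.
set I := pint a b (v^`() ^+ 2).
have key y : a <= y <= b -> (v.[c] - v.[y]) ^+ 2 <= (b - a) * I.
  move=> /andP[ay yb]; wlog yc : y c ac cb ay yb / y <= c.
    by move=> H; have [/H->//|/ltW /H] := leP y c; rewrite -sqrrN opprB; exact.
  rewrite -pint_deriv (le_trans (pint_cauchy_schwarz _ yc))//.
  apply: ler_pM.
  - by rewrite subr_ge0.
  - by apply: pint_ge0 => // x _; rewrite horner_exp sqr_ge0.
  - exact: lerB.
  - by apply: pint_itvS => // x _; rewrite horner_exp sqr_ge0.
rewrite mulrC -pintC.
have -> : 2 * pint a b (v ^+ 2) + 2 * (b - a) ^+ 2 * I =
    pint a b (2 *: v ^+ 2 + (2 * (b - a) * I)%:P).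
  by rewrite linearD linearZ/= pintC; ring.
apply: le_pint => // y /key; rewrite !hornE.
have := sqr_ge0 (v.[c] - 2 * v.[y]); nra.
Qed.

End PolyIntegral.

(** * Orthogonal polynomials *)

Section OrthogonalPolynomials.
Variables (R : rcfType) (b : {poly R}).
Hypothesis b_neq0 : b != 0.
Hypothesis b_ge0 : forall x : R, -1 <= x <= 1 -> 0 <= b.[x].
Implicit Types (p q : {poly R}).

Local Notation J := (pint (-1) 1).

Lemma sqnorm_ge0 q : 0 <= J (b * q ^+ 2).
Proof.
apply: pint_ge0 => [|x x1]; first by lra.
by rewrite hornerM horner_exp mulr_ge0 ?b_ge0 ?sqr_ge0.
Qed.

Lemma sqnorm_eq0 q : J (b * q ^+ 2) = 0 -> q = 0.
Proof.
move=> J0; suff /eqP : b * q ^+ 2 = 0.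
  by rewrite mulf_eq0 (negbTE b_neq0) expf_eq0 /= => /eqP.
apply: pint_eq0 J0 => [|x x1]; first by lra.
by rewrite hornerM horner_exp mulr_ge0 ?b_ge0 ?sqr_ge0.
Qed.

Lemma sqnorm_gt0 q : q != 0 -> 0 < J (b * q ^+ 2).
Proof.
move=> q0; rewrite lt_neqAle sqnorm_ge0 andbT eq_sym.
by apply: contra_neq q0; exact: sqnorm_eq0.
Qed.

Definition ortho_compl p (s : seq {poly R}) : {poly R} :=
  p - \sum_(q <- s) (J (b * p * q) / J (b * q ^+ 2)) *: q.

Fixpoint gram_schmidt n : seq {poly R} :=
  if n is n'.+1 then
    rcons (gram_schmidt n') (ortho_compl 'X^n' (gram_schmidt n'))
  else [::].

(** The monic orthogonal polynomial of degree [n]; for the bubbles used as weights below it is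
    proportional to a Jacobi polynomial. *)
Definition orthopoly n := ortho_compl 'X^n (gram_schmidt n).

Lemma gram_schmidtE n : gram_schmidt n = [seq orthopoly i | i <- iota 0 n].
Proof.
by elim: n => // n IH; rewrite -[in RHS]addn1 iotaD map_cat -IH cats1.
Qed.

Lemma orthopolyE n : orthopoly n = 'X^n - \sum_(i < n)
  (J (b * 'X^n * orthopoly i) / J (b * orthopoly i ^+ 2)) *: orthopoly i.
Proof.
rewrite {1}/orthopoly /ortho_compl gram_schmidtE big_map.
have -> : iota 0 n = index_iota 0 n by rewrite /index_iota subn0.
by rewrite big_mkord.
Qed.

Lemma size_orthopoly n : size (orthopoly n) = n.+1.
Proof.
elim/ltn_ind: n => n IH; rewrite orthopolyE size_polyDl ?size_polyXn//.
rewrite size_polyN ltnS (leq_trans (size_sum _ _ _))//.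
apply/bigmax_leqP => i _; rewrite (leq_trans (size_scale_leq _ _))//.
by rewrite IH.
Qed.

Lemma orthopoly_neq0 n : orthopoly n != 0.
Proof. by rewrite -size_poly_gt0 size_orthopoly. Qed.

Lemma orthopoly_lt j k : (j < k)%N -> J (b * orthopoly k * orthopoly j) = 0.
Proof.
elim/ltn_ind: k j => k IH j jk.
rewrite (orthopolyE k) (mulrBr b) mulrBl linearB /= mulr_sumr mulr_suml linear_sum /=.
rewrite (bigD1 (Ordinal jk)) //= big1 => [|i /eqP ij].
  rewrite addr0 -!(scalerAr, scalerAl) linearZ /= -(mulrA b (orthopoly j)) -expr2 divfK ?subrr//.
  by rewrite gt_eqF// sqnorm_gt0// orthopoly_neq0.
rewrite -!(scalerAr, scalerAl) linearZ /=.
suff -> : J (b * orthopoly i * orthopoly j) = 0 by rewrite mulr0.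
have [ji|ij'|E] := ltngtP i j; [|exact: IH|].
  by rewrite mulrAC IH.
by case: ij; apply: val_inj.
Qed.

Lemma orthopolyP (j k : nat) : j != k -> J (b * orthopoly k * orthopoly j) = 0.
Proof.
by case: ltngtP => // jk _; [|rewrite mulrAC]; exact: orthopoly_lt.
Qed.

Lemma orthopoly_expand n p : (size p <= n)%N ->
  exists c : nat -> R, p = \sum_(k < n) c k *: orthopoly k.
Proof.
elim: n p => [|n IH] p sp.
  exists (fun=> 0); rewrite big_ord0; apply/eqP.
  by rewrite -size_poly_leq0.
pose k := p`_n / (orthopoly n)`_n.
have en0 : (orthopoly n)`_n != 0.
  by rewrite -[X in _`_X]/(n.+1.-1) -size_orthopoly lead_coef_eq0 orthopoly_neq0.
have [|c pE] := IH (p - k *: orthopoly n).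
  apply/leq_sizeP => i; rewrite leq_eqVlt => /predU1P[<-|ni].
    by rewrite coefB coefZ divfK// subrr.
  rewrite coefB coefZ !nth_default ?mulr0 ?subr0// ?size_orthopoly//.
  exact: leq_trans ni.
exists (fun i => if i == n then k else c i).
rewrite big_ord_recr /= eqxx -[LHS](subrK (k *: orthopoly n)) pE; congr (_ + _).
by apply: eq_bigr => i _; rewrite ltn_eqF.
Qed.

Lemma orthopoly_size j p : (size p <= j)%N -> J (b * orthopoly j * p) = 0.
Proof.
move=> /orthopoly_expand[c ->]; rewrite mulr_sumr linear_sum big1 //= => i _.
by rewrite -scalerAr linearZ /= orthopoly_lt ?mulr0.
Qed.

(** Parseval's identity. The predicate [P] makes it apply to the tail of an expansion as well. *)
Lemma sqnorm_sum (c : nat -> R) (P : pred nat) n :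
  J (b * (\sum_(k < n | P k) c k *: orthopoly k) ^+ 2) =
  \sum_(k < n | P k) c k ^+ 2 * J (b * orthopoly k ^+ 2).
Proof.
rewrite expr2 mulrA mulr_sumr linear_sum; apply: eq_bigr => i Pi.
rewrite mulr_sumr mulr_suml linear_sum (bigD1 i) //= big1 => [|k /andP[_ ki]].
  by rewrite addr0 -!(scalerAr, scalerAl) !linearZ /= mulrA -expr2 mulrA.
by rewrite -!(scalerAr, scalerAl) !linearZ /= orthopolyP ?mulr0// eq_sym.
Qed.

End OrthogonalPolynomials.

(** * Jacobi operators *)

Section JacobiOperator.
Variables (R : rcfType) (al be : nat).
Hypotheses (al01 : al \in [:: 0; 1]%N) (be01 : be \in [:: 0; 1]%N).
Implicit Types (p q : {poly R}) (x : R).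

Local Notation J := (pint (-1) 1).

Definition jweight : {poly R} := (1 - 'X) ^+ al * (1 + 'X) ^+ be.
Definition jbubble : {poly R} := (1 - 'X) ^+ (1 - al) * (1 + 'X) ^+ (1 - be).
Definition jdeg : nat := (1 - al) + (1 - be).

Local Notation w := jweight.
Local Notation b := jbubble.
Local Notation m := jdeg.
Local Notation e := (orthopoly b).

Lemma jweight_bubble : w * b = 1 - 'X ^+ 2.
Proof.
rewrite /jweight /jbubble.
by move: al01 be01; rewrite !inE => /orP[] /eqP -> /orP[] /eqP ->;
  rewrite !(expr0, expr1); ring.
Qed.

Lemma horner_jweight_bubble x : w.[x] * b.[x] = 1 - x ^+ 2.
Proof. by rewrite -hornerM jweight_bubble !hornE. Qed.

Lemma horner_jweight x : w.[x] = (1 - x) ^+ al * (1 + x) ^+ be.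
Proof. by rewrite !hornE. Qed.

Lemma horner_jbubble x : b.[x] = (1 - x) ^+ (1 - al) * (1 + x) ^+ (1 - be).
Proof. by rewrite !hornE. Qed.

Lemma jweight_ge0 (x : R) : -1 <= x <= 1 -> 0 <= w.[x].
Proof. by move=> x1; rewrite horner_jweight mulr_ge0// exprn_ge0; lra. Qed.

Lemma jbubble_ge0 (x : R) : -1 <= x <= 1 -> 0 <= b.[x].
Proof. by move=> x1; rewrite horner_jbubble mulr_ge0// exprn_ge0; lra. Qed.

Lemma jbubble_neq0 : b != 0.
Proof.
have : (1 - 'X ^+ 2 : {poly R}) != 0.
  by rewrite -size_poly_gt0 -opprB size_polyN size_XnsubC.
by apply: contraNneq => b0; rewrite -jweight_bubble b0 mulr0.
Qed.

Definition jacobi_op p : {poly R} := - (w * (b * p)^`())^`().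

Lemma jacobi_op_is_linear : linear jacobi_op.
Proof.
move=> k p q; rewrite /jacobi_op mulrDr -scalerAr linearP /=.
by rewrite mulrDr -scalerAr linearP /= opprD scalerN.
Qed.
HB.instance Definition _ :=
  GRing.isLinear.Build R {poly R} {poly R} _ jacobi_op jacobi_op_is_linear.

(** Equal to [k^2 + (m + 1) k + m], the factor by which [jacobi_op] multiplies the top coefficient
    of a polynomial of degree [k]. *)
Definition jacobi_eigen k : R := (k.+1 * (k + m))%:R.

(** The form in terms of the Euler operator [x d/dx], which multiplies the coefficient of degree [i]
    by [i]: the action on top coefficients can be read off. *)
Lemma jacobi_opE p :
  jacobi_op p = - p^`()^`() + 'X * ('X * p^`())^`() + (m.+1%:R) * ('X * p^`())
                - (al%:R - be%:R) * p^`() + m%:R * p.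
Proof.
rewrite /jacobi_op /jweight /jbubble /jdeg.
by move: al01 be01; rewrite !inE => /orP[] /eqP -> /orP[] /eqP ->;
  rewrite !(subn0, subnn, addn0, add0n, addn1, expr0, expr1, derivE) ?polyC1; ring.
Qed.

Lemma coef_euler p i : ('X * p^`())`_i = i%:R * p`_i.
Proof. by rewrite coefXM coef_deriv; case: i => [|i] /=; rewrite ?mul0r// mulr_natl. Qed.

Lemma coef_natM k p i : (k%:R * p)`_i = k%:R * p`_i.
Proof. by rewrite !mulr_natl coefMn. Qed.

Lemma size_jacobi_op k p : (size p <= k.+1)%N ->
  (size (jacobi_op p - jacobi_eigen k *: p)%R <= k)%N.
Proof.
move=> sp; apply/leq_sizeP => i ki.
have p1 : p`_i.+1 = 0 by rewrite nth_default// (leq_trans sp).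
have p2 : p`_i.+2 = 0 by rewrite nth_default// (leq_trans sp)// ltnW.
rewrite jacobi_opE mulrBl !(coefD, coefN, coefZ, coef_natM, coef_euler, coef_deriv).
rewrite p1 p2 !mul0rn /jacobi_eigen !mulr0; move: ki; rewrite leq_eqVlt => /predU1P[<-|ki].
  by rewrite natrM natrD -!natr1; ring.
by rewrite nth_default ?(leq_trans sp)// !mulr0; ring.
Qed.

Lemma jacobi_op_parts p q :
  J (b * p * jacobi_op q) = J (w * (b * p)^`() * (b * q)^`()).
Proof.
rewrite /jacobi_op mulrN linearN /=.
have := pint_parts (-1) 1 (b * p) (w * (b * q)^`()).
(* The boundary terms contain the factor [w b = 1 - x^2]. *)
have z x : x ^+ 2 = 1 -> (b * p).[x] * (w * (b * q)^`()).[x] = 0.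
  move=> x2; rewrite (hornerM b) (hornerM w) mulrACA (mulrC b.[x]).
  by rewrite horner_jweight_bubble x2 subrr mul0r.
rewrite !z ?sqrrN ?expr1n// subrr sub0r => /eqP; rewrite -eqr_oppLR => /eqP <-.
by rewrite opprK mulrA (mulrC _ w).
Qed.

Lemma jacobi_op_sym p q : J (b * p * jacobi_op q) = J (b * q * jacobi_op p).
Proof. by rewrite !jacobi_op_parts mulrAC. Qed.

(* [jacobi_op] is symmetric for the weight [b] and triangular in the degree,
   hence diagonal on polynomials orthogonal to all those of lower degree. *)
Lemma jacobi_op_eigen k p : (size p <= k.+1)%N ->
  (forall q, (size q <= k)%N -> J (b * p * q) = 0) ->
  jacobi_op p = jacobi_eigen k *: p.
Proof.
move=> sp op; set r := jacobi_op p - jacobi_eigen k *: p.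
have sr : (size r <= k)%N by rewrite size_jacobi_op.
suff /eqP : r = 0 by rewrite subr_eq0 => /eqP.
apply: (sqnorm_eq0 jbubble_neq0 jbubble_ge0).
(* The residual [r] has lower degree than [p], so its product with [p] integrates to 0. By symmetry
   the other term is the product of [p] with [jacobi_op r], again of lower degree. *)
have -> : b * r ^+ 2 = b * r * jacobi_op p - jacobi_eigen k *: (b * p * r).
  by rewrite -mul_polyC /r -mul_polyC; ring.
rewrite linearB linearZ /= op// mulr0 subr0 jacobi_op_sym op//.
have [k0|k0] := posnP k.
  move: sr; rewrite k0 size_poly_leq0 => /eqP ->.
  by rewrite linear0 size_poly0.
rewrite -(prednK k0) in sr *.
rewrite -[jacobi_op r](subrK (jacobi_eigen k.-1 *: r)).
rewrite (leq_trans (size_polyD _ _))// geq_max (leq_trans (size_jacobi_op sr))//.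
by rewrite (leq_trans (size_scale_leq _ _)).
Qed.

Lemma jacobi_op_orthopoly k : jacobi_op (e k) = jacobi_eigen k *: e k.
Proof.
apply: jacobi_op_eigen => [|q sq]; first by rewrite size_orthopoly.
by rewrite orthopoly_size//; [exact: jbubble_neq0|exact: jbubble_ge0].
Qed.

Lemma jacobi_eigen_mono j k : (j <= k)%N -> jacobi_eigen j <= jacobi_eigen k.
Proof. by move=> jk; rewrite ler_nat leq_mul// leq_add2r. Qed.

Lemma jacobi_eigen_ge0 j : 0 <= jacobi_eigen j.
Proof. exact: ler0n. Qed.

Lemma jacobi_op_sum (c : nat -> R) (P : pred nat) n :
  jacobi_op (\sum_(k < n | P k) c k *: e k) =
  \sum_(k < n | P k) (c k * jacobi_eigen k) *: e k.
Proof.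
rewrite linear_sum; apply: eq_bigr => i _.
by rewrite linearZ /= jacobi_op_orthopoly scalerA.
Qed.

(** The products [b e_k], being eigenfunctions, are orthogonal for the energy too, with the
    eigenvalue as additional factor. *)
Lemma energy_sum (c : nat -> R) (P : pred nat) n :
  J (w * (b * \sum_(k < n | P k) c k *: e k)^`() ^+ 2) =
  \sum_(k < n | P k) c k ^+ 2 * jacobi_eigen k * J (b * e k ^+ 2).
Proof.
rewrite expr2 mulrA -jacobi_op_parts jacobi_op_sum mulr_sumr linear_sum.
apply: eq_bigr => i Pi; rewrite mulr_sumr mulr_suml linear_sum.
rewrite (bigD1 i) //= big1 => [|k /andP[_ ki]].
  rewrite addr0 -!(scalerAr, scalerAl) !linearZ /= -(mulrA b) -expr2; ring.
rewrite -!(scalerAr, scalerAl) !linearZ /= orthopolyP ?mulr0//.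
- exact: jbubble_neq0.
- exact: jbubble_ge0.
- by rewrite eq_sym.
Qed.

(** Compare the two Parseval sums term by term: [jacobi_eigen n.-1] bounds every eigenvalue that
    occurs. *)
Lemma inverse_inequality n p : (size p <= n)%N ->
  J (w * (b * p)^`() ^+ 2) <= jacobi_eigen n.-1 * J (b * p ^+ 2).
Proof.
move=> /(orthopoly_expand b)[c ->].
rewrite (energy_sum c predT) (sqnorm_sum jbubble_neq0 jbubble_ge0 c predT).
rewrite mulr_sumr; apply: ler_sum => i _.
rewrite mulrAC [leRHS]mulrC ler_wpM2l//.
  by rewrite mulr_ge0 ?sqr_ge0// sqnorm_ge0//; exact: jbubble_ge0.
by rewrite jacobi_eigen_mono// -ltnS prednK// (leq_ltn_trans _ (ltn_ord i)).
Qed.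

End JacobiOperator.

(** * Inverse inequalities for the weight [1 - x^2] *)

(** The case [al = be = 1]: the bubble is 1 and the eigenvalues are those of Legendre's equation. *)
Lemma legendre_inverse_inequality (R : rcfType) (n : nat) (q : {poly R}) :
  (size q <= n.+1)%N ->
  pint (-1) 1 ((1 - 'X ^+ 2) * q^`() ^+ 2) <= (n * n.+1)%:R * pint (-1) 1 (q ^+ 2).
Proof.
move=> sq; have := @inverse_inequality R 1 1 _ _ n.+1 q sq.
rewrite /jbubble /jweight !expr0 !expr1 !mul1r /jacobi_eigen /jdeg addn0 mulnC.
have -> : (1 - 'X) * (1 + 'X) = 1 - 'X ^+ 2 :> {poly R} by ring.
by apply; rewrite !inE.
Qed.

(* Integrating [((1 - x^2) x q^2)'] gives [∫ (3 x^2 - 1) q^2 = 2 ∫ (1 - x^2) x q q'];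
   the right-hand side is controlled by the inverse inequality. *)
Lemma schur_inequality (R : rcfType) (n : nat) (q : {poly R}) :
  (size q <= n.+1)%N ->
  pint (-1) 1 (q ^+ 2) <=
  (3 + (n * n.+1)%:R) * pint (-1) 1 ((1 - 'X ^+ 2) * q ^+ 2).
Proof.
move=> sq; have inv := legendre_inverse_inequality sq.
move: inv; set l : R := (n * n.+1)%:R => inv.
have l0 : 0 <= l by exact: ler0n.
set I := pint (-1) 1 (q ^+ 2) in inv *.
set K := pint (-1) 1 ((1 - 'X ^+ 2) * q ^+ 2).
set D := pint (-1) 1 ((1 - 'X ^+ 2) * q^`() ^+ 2) in inv.
pose M := pint (-1) 1 ((1 - 'X ^+ 2) * 'X * q * q^`()).
have E : 2 * M = 2 * I - 3 * K.
  have := pint_deriv (-1) 1 ((1 - 'X ^+ 2) * 'X * q ^+ 2).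
  rewrite !hornE sqrrN expr1n subrr !mul0r subrr.
  have -> : ((1 - 'X ^+ 2) * 'X * q ^+ 2)^`() =
     3 *: ((1 - 'X ^+ 2) * q ^+ 2) - 2 *: q ^+ 2 + 2 *: ((1 - 'X ^+ 2) * 'X * q * q^`()).
    rewrite -!mul_polyC !derivE !expr1 /= !polyCMn; ring.
  by rewrite linearD linearB !linearZ /= -/M -/I -/K; lra.
have K0 : 0 <= K.
  by apply: pint_ge0 => [|x x1]; [lra|rewrite !hornE mulr_ge0 ?sqr_ge0//; nra].
(* The integrand of the difference is [(1 - x^2) ((l x q - q')^2 + l^2 q^2 (1 - x^2))]. *)
have key : 2 * l * M <= l ^+ 2 * K + D.
  rewrite -!linearZ -linearD le_pint// => [|x x1]; first by lra.
  rewrite !hornE; set y := q.[x]; set z := q^`().[x].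
  have : 0 <= (1 - x ^+ 2) * ((l * x * y - z) ^+ 2 + (l * y) ^+ 2 * (1 - x ^+ 2)).
    have x2 : 0 <= 1 - x ^+ 2 by nra.
    by rewrite mulr_ge0// addr_ge0 ?sqr_ge0// mulr_ge0 ?sqr_ge0.
  lra.
(* The conclusion follows after division by [l], which is 0 for [n = 0]; then [q] is constant and
   [M = 0]. *)
have [n0|n0] := posnP n.
  have q'0 : q^`() = 0 by move: sq; rewrite n0 => /size1_polyC ->; rewrite derivC.
  have M0 : M = 0 by rewrite /M q'0 mulr0 linear0.
  by have := mulr_ge0 l0 K0; lra.
have lp : 0 < l by rewrite ltr0n muln_gt0 n0.
rewrite -(ler_pM2l lp); nra.
Qed.

(** * Polynomial approximation *)

Section Bernstein.
Variable R : realFieldType.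
Implicit Types (g h : nat -> R) (x c : R).

(* The Bernstein polynomial on [-1, 1] of degree [n] with coefficients
   [g 0, ..., g n]. *)
Fixpoint bernstein (n : nat) g : {poly R} :=
  if n is n'.+1 then
    2^-1 *: ((1 + 'X) * bernstein n' (g \o succn) + (1 - 'X) * bernstein n' g)
  else (g 0%N)%:P.

Lemma horner_bernstein n g x : (bernstein n.+1 g).[x] =
  (1 + x) / 2 * (bernstein n (g \o succn)).[x] + (1 - x) / 2 * (bernstein n g).[x].
Proof. by rewrite /= !hornE mulrDr !mulrA !(mulrC 2^-1). Qed.

Lemma eq_bernstein n g h : g =1 h -> bernstein n g = bernstein n h.
Proof.
elim: n g h => [|n IH] g h gh /=; first by rewrite gh.
by rewrite (IH g h)// (IH _ (h \o succn))// => k /=.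
Qed.

Lemma bernstein_left n g : (bernstein n g).[-1] = g 0%N.
Proof. by elim: n g => [|n IH] g; rewrite ?horner_bernstein ?IH /= ?hornerC//; lra. Qed.

Lemma bernstein_right n g : (bernstein n g).[1] = g n.
Proof. by elim: n g => [|n IH] g; rewrite ?horner_bernstein ?IH /= ?hornerC//; lra. Qed.

Lemma bernstein_sub n g c x :
  (bernstein n g).[x] - c = (bernstein n (fun k => g k - c)).[x].
Proof.
elim: n g => [|n IH] g; first by rewrite /= !hornerC.
by rewrite !horner_bernstein -!IH; field.
Qed.

Lemma bernstein_scale n g c x :
  (bernstein n (fun k => c * g k)).[x] = c * (bernstein n g).[x].
Proof.
elim: n g => [|n IH] g; first by rewrite /= !hornerC.
by rewrite !horner_bernstein (IH g) (IH (g \o succn)); field.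
Qed.

Lemma le_bernstein n g h x : -1 <= x <= 1 -> (forall k, (k <= n)%N -> g k <= h k) ->
  (bernstein n g).[x] <= (bernstein n h).[x].
Proof.
move=> x1; elim: n g h => [|n IH] g h gh; first by rewrite /= !hornerC gh.
by rewrite !horner_bernstein lerD// ler_wpM2l//; (lra || apply: IH => k kn; apply: gh);
  rewrite ?ltnS// ltnW.
Qed.

(** Jensen's inequality: each step of the recursion averages with the weights [(1 + x) / 2] and
    [(1 - x) / 2]. *)
Lemma bernstein_sqr n g x : -1 <= x <= 1 ->
  (bernstein n g).[x] ^+ 2 <= (bernstein n (fun k => g k ^+ 2)).[x].
Proof.
move=> x1; elim: n g => [|n IH] g; first by rewrite /= !hornerC.
rewrite !horner_bernstein.
have x2 : 0 <= (1 + x) / 2 by lra.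
have x3 : 0 <= (1 - x) / 2 by lra.
have := lerD (ler_wpM2l x2 (IH (g \o succn))) (ler_wpM2l x3 (IH g)).
apply: le_trans; set s := _.[x]; set t := _.[x].
have : 0 <= (1 - x ^+ 2) * (s - t) ^+ 2 by rewrite mulr_ge0 ?sqr_ge0//; nra.
lra.
Qed.

(** The second moment about [c] of the binomial law with [n] trials and success probability
    [(1 + x) / 2]. *)
Lemma bernstein_variance n c x : (bernstein n (fun k => (k%:R - c) ^+ 2)).[x] =
  (n%:R * (1 + x) / 2 - c) ^+ 2 + n%:R * (1 - x ^+ 2) / 4.
Proof.
elim: n c => [|n IH] c; first by rewrite /= hornerC; ring.
rewrite horner_bernstein IH.
rewrite (@eq_bernstein n _ (fun k => (k%:R - (c - 1)) ^+ 2)); last first.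
  by move=> k /=; rewrite -natr1; congr (_ ^+ 2); ring.
by rewrite IH -natr1; field.
Qed.

(** Jensen's inequality reduces the error to the binomial variance. The factor [1 - x^2] is kept
    because the error will be compared with the bubble, which may vanish at the ends. *)
Lemma bernstein_approx (f : R -> R) (L : R) n x : -1 <= x <= 1 ->
  (forall s t : R, -1 <= s <= 1 -> -1 <= t <= 1 ->
    (f s - f t) ^+ 2 <= L * (s - t) ^+ 2) -> (0 < n)%N ->
  ((bernstein n (fun k => f (2 * k%:R / n%:R - 1))).[x] - f x) ^+ 2 <=
  L * (1 - x ^+ 2) / n%:R.
Proof.
move=> x1 fL n0; have n0' : 0 < n%:R :> R by rewrite ltr0n.
rewrite bernstein_sub; apply: le_trans (bernstein_sqr _ _ x1) _.
pose h k : R := (L * (2 / n%:R) ^+ 2) * (k%:R - n%:R * (1 + x) / 2) ^+ 2.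
apply: (@le_trans _ _ (bernstein n h).[x]).
  apply: le_bernstein => // k kn.
  have k01 : 0 <= (k%:R / n%:R : R) <= 1.
    by rewrite divr_ge0//= ler_pdivrMr// mul1r ler_nat.
  apply: le_trans (fL _ _ _ x1) _; first by move: k01; rewrite -mulrA; lra.
  rewrite le_eqVlt; apply/orP; left; apply/eqP; rewrite /h; field.
  by rewrite gt_eqF.
rewrite bernstein_scale bernstein_variance subrr expr0n add0r le_eqVlt.
by apply/orP; left; apply/eqP; field; rewrite gt_eqF.
Qed.

End Bernstein.

(** * Divisibility by the bubble *)

Section BubbleFactor.
Variables (R : rcfType) (al be : nat).
Hypotheses (al01 : al \in [:: 0; 1]%N) (be01 : be \in [:: 0; 1]%N).
Implicit Types p : {poly R}.

Lemma size_jbubble : size (jbubble R al be) = (jdeg al be).+1.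
Proof.
have s1 : size (1 + 'X : {poly R}) = 2 by rewrite addrC -polyC1 size_XaddC.
have s2 : size (1 - 'X : {poly R}) = 2 by rewrite -opprB size_polyN -polyC1 size_XsubC.
have s3 : size ((1 - 'X) * (1 + 'X) : {poly R}) = 3.
  by rewrite size_mul -?size_poly_gt0 ?s1 ?s2.
by move: al01 be01; rewrite !inE => /orP[] /eqP -> /orP[] /eqP ->;
  rewrite /jbubble /jdeg ?subnn ?subn0 ?expr0 ?expr1 ?mul1r ?mulr1 ?size_poly1.
Qed.

Lemma jbubble_factor p : (al = 0%N -> p.[1] = 0) -> (be = 0%N -> p.[-1] = 0) ->
  exists q, p = jbubble R al be * q.
Proof.
have f1 (q : {poly R}) : q.[1] = 0 -> exists r, q = (1 - 'X) * r.
  move=> /rootP/factor_theorem[r ->]; exists (- r).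
  by rewrite polyC1; ring.
have f2 (q : {poly R}) : q.[-1] = 0 -> exists r, q = (1 + 'X) * r.
  move=> /rootP/factor_theorem[r ->]; exists r.
  by rewrite polyCN polyC1; ring.
rewrite /jbubble.
move: al01 be01; rewrite !inE => /orP[] /eqP -> /orP[] /eqP ->;
  rewrite ?subnn ?subn0 ?expr0 ?expr1 ?mul1r ?mulr1 => p1 p2.
- have [q qE] := f1 p (p1 erefl); have [r rE] : exists r, q = (1 + 'X) * r.
    apply: f2; have := p2 erefl; rewrite qE !hornE => /eqP.
    by rewrite mulf_eq0 => /orP[/eqP|/eqP//]; lra.
  by exists r; rewrite qE rE mulrA.
- exact: f1 (p1 erefl).
- exact: f2 (p2 erefl).
- by exists p; rewrite mul1r.
Qed.

End BubbleFactor.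

(** * Spectral projection of a piecewise polynomial function *)

Section PiecewiseIntegral.
Variables (R : rcfType) (N : nat) (x : nat -> R).
Hypothesis x_lt : forall k, (k < N)%N -> x k < x k.+1.
Implicit Types (F H : nat -> {poly R}) (p : {poly R}).

(** The pieces may disagree at the nodes. Indices are in [nat], so that neighbouring cells are
    reached without casts. *)
Definition pw F : R := \sum_(k < N) pint (x k) (x k.+1) (F k).

Lemma eq_pw F H : (forall k, (k < N)%N -> F k = H k) -> pw F = pw H.
Proof. by move=> FH; apply: eq_bigr => k _; rewrite FH. Qed.

Lemma pwD F H : pw (fun k => F k + H k) = pw F + pw H.
Proof. by rewrite /pw -big_split; apply: eq_bigr => k _; rewrite linearD. Qed.

Lemma pwZ a F : pw (fun k => a *: F k) = a * pw F.
Proof. by rewrite /pw mulr_sumr; apply: eq_bigr => k _; rewrite linearZ. Qed.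

Lemma pwB F H : pw (fun k => F k - H k) = pw F - pw H.
Proof. by rewrite /pw -sumrB; apply: eq_bigr => k _; rewrite linearB. Qed.

Lemma pw_sum (I : Type) (r : seq I) (P : pred I) (F : I -> nat -> {poly R}) :
  pw (fun k => \sum_(i <- r | P i) F i k) = \sum_(i <- r | P i) pw (F i).
Proof.
by rewrite /pw exchange_big; apply: eq_bigr => k _; rewrite linear_sum.
Qed.

Lemma le_pw F H :
  (forall k t, (k < N)%N -> x k <= t <= x k.+1 -> (F k).[t] <= (H k).[t]) ->
  pw F <= pw H.
Proof.
by move=> FH; apply: ler_sum => k _; apply: le_pint => [|t]; [exact/ltW/x_lt|exact: FH].
Qed.

Lemma pw_ge0 F :
  (forall k t, (k < N)%N -> x k <= t <= x k.+1 -> 0 <= (F k).[t]) -> 0 <= pw F.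
Proof.
by move=> FH; apply: sumr_ge0 => k _; apply: pint_ge0 => [|t]; [exact/ltW/x_lt|exact: FH].
Qed.

Lemma pw_poly p : pw (fun=> p) = pint (x 0) (x N) p.
Proof.
have telescope n : \sum_(k < n) pint (x k) (x k.+1) p = pint (x 0) (x n) p.
  elim: n => [|n IH]; first by rewrite big_ord0 /pint subrr.
  by rewrite big_ord_recr /= IH -pint_cat.
exact: telescope.
Qed.

Lemma pw_deriv F : (forall k, (k.+1 < N)%N -> (F k).[x k.+1] = (F k.+1).[x k.+1]) ->
  (0 < N)%N -> pw (fun k => (F k)^`()) = (F N.-1).[x N] - (F 0%N).[x 0].
Proof.
move=> Fc N0; have telescope n : (n < N)%N ->
    \sum_(k < n.+1) pint (x k) (x k.+1) (F k)^`() = (F n).[x n.+1] - (F 0%N).[x 0].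
  elim: n => [|n IH] nN; first by rewrite big_ord_recl big_ord0 /= addr0 pint_deriv.
  rewrite big_ord_recr /= IH 1?ltnW// pint_deriv Fc//; ring.
by rewrite /pw; have := telescope N.-1; rewrite prednK// leqnn; apply.
Qed.

Lemma node_le i j : (i <= j <= N)%N -> x i <= x j.
Proof.
move=> /andP[ij jN]; elim: j ij jN => [|j IH]; first by rewrite leqn0 => /eqP ->.
rewrite leq_eqVlt => /predU1P[-> //|]; rewrite ltnS => ij jN.
by rewrite (le_trans (IH ij (ltnW jN)))// ltW// x_lt.
Qed.

End PiecewiseIntegral.

(** * The truncated Jacobi expansion and its error *)

Section Projection.
Variables (R : rcfType) (al be : nat).
Hypotheses (al01 : al \in [:: 0; 1]%N) (be01 : be \in [:: 0; 1]%N).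
Variables (N : nat) (x : nat -> R) (U : nat -> {poly R}).
Hypothesis N_gt0 : (0 < N)%N.
Hypothesis x_lt : forall k, (k < N)%N -> x k < x k.+1.
Hypotheses (x0 : x 0 = -1) (xN : x N = 1).
Hypothesis U_cont : forall k, (k.+1 < N)%N -> (U k).[x k.+1] = (U k.+1).[x k.+1].
Hypothesis U_right : al = 0%N -> (U N.-1).[1] = 0.
Hypothesis U_left : be = 0%N -> (U 0%N).[-1] = 0.

Local Notation J := (pint (-1) 1).
Local Notation w := (jweight R al be).
Local Notation b := (jbubble R al be).
Local Notation e := (orthopoly b).
Local Notation lam := (jacobi_eigen R al be).
Local Notation pw := (pw N x).

Let b_neq0 : b != 0. Proof. exact: jbubble_neq0. Qed.
Let b_ge0 (t : R) : -1 <= t <= 1 -> 0 <= b.[t]. Proof. exact: jbubble_ge0. Qed.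

Let cell_itv k t : (k < N)%N -> x k <= t <= x k.+1 -> -1 <= t <= 1.
Proof.
move=> kN /andP[kt tk]; rewrite -x0 -xN; apply/andP; split.
  by rewrite (le_trans _ kt)// (node_le x_lt)// (ltnW kN).
by rewrite (le_trans tk)// (node_le x_lt)// leqnn andbT.
Qed.

(** The coefficient of [U] along [b e_k] for the weight [1 / b]: the weight cancels the bubble, and
    only polynomials are integrated. *)
Definition fourier k : R := pw (fun i => U i * e k) / J (b * e k ^+ 2).

Definition jacobi_proj n : {poly R} := b * \sum_(k < n) fourier k *: e k.

Definition energy : R := pw (fun i => w * (U i)^`() ^+ 2).

Lemma size_proj n : (size (jacobi_proj n) <= jdeg al be + n)%N.
Proof.
rewrite (leq_trans (size_polyMleq _ _))// size_jbubble// addSn leq_add2l.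
apply: (leq_trans (size_sum _ _ _)); apply/bigmax_leqP => k _.
by rewrite (leq_trans (size_scale_leq _ _))// size_orthopoly.
Qed.

Lemma orthopoly_sqnorm_gt0 k : 0 < J (b * e k ^+ 2).
Proof. exact/sqnorm_gt0/orthopoly_neq0. Qed.

Lemma pw_fourier k : pw (fun i => U i * e k) = fourier k * J (b * e k ^+ 2).
Proof. by rewrite /fourier divfK// gt_eqF// orthopoly_sqnorm_gt0. Qed.

(** Integration by parts on each cell with the eigenvalue equation for [e_k]. The boundary terms
    cancel at inner nodes by continuity; at each end either [U] or [w] vanishes. *)
Lemma pw_energy_orthopoly k : pw (fun i => w * (U i)^`() * (b * e k)^`()) =
  lam k * fourier k * J (b * e k ^+ 2).
Proof.
pose H i := U i * (w * (b * e k)^`()).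
have -> : pw (fun i => w * (U i)^`() * (b * e k)^`()) =
    pw (fun i => (H i)^`() + lam k *: (U i * e k)).
  apply: eq_pw => i _; rewrite /H (derivM (U i)); have := jacobi_op_orthopoly R al01 be01 k.
  move=> /eqP; rewrite /jacobi_op eqr_oppLR => /eqP ->.
  by rewrite mulrN -scalerAr addrNK; ring.
rewrite pwD pwZ pw_fourier mulrA pw_deriv//; last first.
  by move=> i iN; rewrite /H hornerM U_cont// -hornerM.
suff [-> ->] : (H N.-1).[x N] = 0 /\ (H 0%N).[x 0] = 0 by rewrite subrr add0r.
rewrite xN x0 /H !(hornerM (U _)) !(hornerM w) !horner_jweight; split.
  have [/U_right ->|al1] : al = 0%N \/ al = 1%N.
    by move: al01; rewrite !inE => /orP[] /eqP; [left|right].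
    by rewrite mul0r.
  by rewrite al1 subrr !mul0r mulr0.
have [/U_left ->|be1] : be = 0%N \/ be = 1%N.
  by move: be01; rewrite !inE => /orP[] /eqP; [left|right].
  by rewrite mul0r.
by rewrite be1 subrr mulr0 mul0r mulr0.
Qed.

Lemma energy_proj n : J (w * (jacobi_proj n)^`() ^+ 2) =
  \sum_(k < n) fourier k ^+ 2 * lam k * J (b * e k ^+ 2).
Proof. exact: (energy_sum al01 be01 fourier predT). Qed.

(** Bessel's inequality: expand the energy of [U] minus its projection, where the cross term equals
    the energy of the projection. *)
Lemma energy_proj_le n : J (w * (jacobi_proj n)^`() ^+ 2) <= energy.
Proof.
have cross : pw (fun i => w * (U i)^`() * (jacobi_proj n)^`()) = J (w * (jacobi_proj n)^`() ^+ 2).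
  rewrite energy_proj.
  transitivity (pw (fun i => \sum_(k < n) fourier k *: (w * (U i)^`() * (b * e k)^`()))).
    apply: eq_pw => i _; rewrite /jacobi_proj mulr_sumr raddf_sum mulr_sumr.
    by apply: eq_bigr => k _; rewrite -!scalerAr /= derivZ -scalerAr.
  rewrite pw_sum; apply: eq_bigr => k _; rewrite pwZ pw_energy_orthopoly; ring.
have : 0 <= pw (fun i => w * ((U i)^`() - (jacobi_proj n)^`()) ^+ 2).
  apply: (pw_ge0 x_lt) => i t iN /(cell_itv iN) t1.
  by rewrite hornerM horner_exp mulr_ge0 ?sqr_ge0// jweight_ge0.
have -> : pw (fun i => w * ((U i)^`() - (jacobi_proj n)^`()) ^+ 2) =
   energy - 2 * pw (fun i => w * (U i)^`() * (jacobi_proj n)^`()) +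
   pw (fun=> w * (jacobi_proj n)^`() ^+ 2).
  rewrite -pwZ -pwB -pwD; apply: eq_pw => i _; rewrite -mul_polyC polyCMn; ring.
by rewrite pw_poly x0 xN cross; lra.
Qed.

(* Bessel's inequality bounds the tail of the expansion of [U], and its remainder
   is negligible because [b * chi] approximates [U]. *)
Lemma proj_error n (eps : R) (chi : {poly R}) : 0 < eps -> eps <= 1 ->
  (forall k t, (k < N)%N -> x k <= t <= x k.+1 ->
    ((U k).[t] - b.[t] * chi.[t]) ^+ 2 <= eps ^+ 2 * b.[t]) ->
  0 < lam n ->
  J (b * (chi - \sum_(k < n) fourier k *: e k) ^+ 2) <=
  2 * (energy / lam n) + 4 * eps.
Proof.
move=> eps0 eps1 Uchi lam_gt0.
pose M := maxn (size chi) n.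
have [a chiE] := orthopoly_expand b (leq_maxl (size chi) n).
rewrite -/M in chiE.
(* [rho] carries the coefficients of [U - b chi], and [tau] is the part of the expansion of [U] from
   degree [n] up to [M]. *)
pose rho := \sum_(k < M) (fourier k - a k) *: e k.
pose tau := \sum_(k < M | (n <= k)%N) fourier k *: e k.
have zE : chi - \sum_(k < n) fourier k *: e k = tau - rho.
  have -> : \sum_(k < n) fourier k *: e k =
      \sum_(k < M | (k < n)%N) fourier k *: e k.
    by rewrite (big_ord_widen _ (fun k => fourier k *: e k) (leq_maxr (size chi) n)).
  have -> : rho = \sum_(k < M) fourier k *: e k - chi.
    by rewrite chiE -sumrB; apply: eq_bigr => k _; rewrite scalerBl.
  rewrite [\sum_(k < M) _](bigID (fun k : 'I_M => (k < n)%N)) /=.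
  have -> : \sum_(k < M | ~~ (k < n)%N) fourier k *: e k = tau.
    by apply: eq_bigl => k; rewrite -leqNgt.
  by ring.
have rhoM : J (b * rho ^+ 2) <= 2 * eps.
  (* [b rho] is a projection of [U - b chi], so its squared norm is its product with [U - b chi]. *)
  have rhoE : J (b * rho ^+ 2) = pw (fun i => (U i - b * chi) * rho).
    rewrite (sqnorm_sum b_neq0 b_ge0 (fun k => fourier k - a k) predT).
    transitivity (pw (fun i => \sum_(k < M)
        (fourier k - a k) *: ((U i - b * chi) * e k))); last first.
      apply: eq_pw => i _; rewrite /rho mulr_sumr.
      by apply: eq_bigr => k _; rewrite -scalerAr.
    rewrite pw_sum; apply: eq_bigr => k _; rewrite pwZ.
    have -> : pw (fun i => (U i - b * chi) * e k) =
       pw (fun i => U i * e k) - pw (fun=> b * chi * e k).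
      by rewrite -pwB; apply: eq_pw => i _; rewrite mulrBl.
    rewrite pw_fourier pw_poly x0 xN.
    have -> : J (b * chi * e k) = a k * J (b * e k ^+ 2).
      rewrite {1}chiE mulr_sumr mulr_suml linear_sum (bigD1 k) //= big1.
        by rewrite addr0 -scalerAr -scalerAl linearZ /= -mulrA -expr2.
      move=> i ik; rewrite -scalerAr -scalerAl linearZ /=.
      by rewrite (orthopolyP b_neq0 b_ge0) ?mulr0// eq_sym.
    by ring.
  (* Young's inequality after [|U - b chi| <= eps sqrt b]; as [eps <= 1], at most half of the norm
     of [rho] appears on the right and is absorbed. *)
  have : pw (fun i => (U i - b * chi) * rho) <=
      pw (fun=> (eps / 2) *: (1 + b * rho ^+ 2)).
    apply: (le_pw x_lt) => k t kN kt; have t1 := cell_itv kN kt.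
    rewrite /= hornerM hornerD hornerN (hornerM b) hornerZ hornerD -polyC1 hornerC.
    rewrite (hornerM b) horner_exp.
    have := Uchi k t kN kt; have := b_ge0 t1.
    set B := b.[t]; set r := rho.[t]; set d := (U k).[t] - _ => B0 dB.
    have h1 : (d * r) ^+ 2 <= (eps / 2 * (1 + B * r ^+ 2)) ^+ 2.
      rewrite exprMn; apply: le_trans (ler_wpM2r (sqr_ge0 r) dB) _.
      have := sqr_ge0 (eps * (1 - B * r ^+ 2)); lra.
    have h2 : 0 <= eps / 2 * (1 + B * r ^+ 2).
      by rewrite mulr_ge0//; [lra|rewrite addr_ge0// mulr_ge0 ?sqr_ge0].
    have [dr|dr] := leP (d * r) 0; first exact: le_trans h2.
    by rewrite -ler_sqr ?nnegrE// ltW.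
  rewrite -rhoE pw_poly x0 xN linearZ linearD /= -polyC1 pintC.
  have := sqnorm_ge0 b_ge0 rho; nra.
(* In the tail all eigenvalues are at least [lam n], so its norm is controlled by its energy, which
   Bessel's inequality bounds. *)
have tauM : J (b * tau ^+ 2) <= energy / lam n.
  rewrite ler_pdivlMr// mulrC (sqnorm_sum b_neq0 b_ge0 fourier (fun k => n <= k)%N).
  apply: le_trans (energy_proj_le M); rewrite energy_proj mulr_sumr.
  rewrite [leRHS](bigID (fun k : 'I_M => (n <= k)%N)) /= -[leLHS]addr0.
  apply: lerD; last first.
    apply: sumr_ge0 => k _; apply: mulr_ge0; last exact/ltW/orthopoly_sqnorm_gt0.
    by rewrite mulr_ge0 ?sqr_ge0 ?jacobi_eigen_ge0.
  apply: ler_sum => k nk; rewrite mulrA (mulrC (lam n)).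
  rewrite ler_wpM2r ?(ltW (orthopoly_sqnorm_gt0 _))//.
  by rewrite ler_wpM2l ?sqr_ge0// jacobi_eigen_mono.
rewrite zE; apply: (@le_trans _ _ (2 * J (b * tau ^+ 2) + 2 * J (b * rho ^+ 2))).
  rewrite -!linearZ -linearD /= le_pint// => [|t t1]; first by lra.
  rewrite !(hornerD, hornerN, hornerZ, hornerM b, horner_exp).
  have := mulr_ge0 (b_ge0 t1) (sqr_ge0 (tau.[t] + rho.[t])); lra.
move: tauM; move: (energy / lam n) => Q tauM; lra.
Qed.

End Projection.

Require Import Defs.
From mathcomp Require Import all_classical all_reals all_analysis.
From mathcomp Require Import measurable_realfun.

Import Order.TTheory GRing.Theory Num.Theory.
Import numFieldNormedType.Exports.

Local Open Scope ring_scope.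

(** * Legendre polynomials and their critical points *)

(** The derivative of [n / d] has the sign of [n' d - n d']; the conclusion is cleared of
    denominators. *)
Lemma poly_quot_antitone (R : realType) (n d : {poly R}) (a b : R) : a <= b ->
  (forall x, a <= x <= b -> 0 < d.[x]) ->
  (forall x, a <= x <= b -> (n^`() * d - n * d^`()).[x] <= 0) ->
  n.[b] * d.[a] <= n.[a] * d.[b].
Proof.
move=> ab d_gt0 w_le0.
pose f x := n.[x] * (d.[x])^-1.
have df x : a <= x <= b ->
    is_derive x (1 : R) f (n.[x] *: (- (d.[x]) ^- 2 *: d^`().[x]) + (d.[x])^-1 *: n^`().[x]).
  move=> xab; apply: is_deriveM; apply: is_deriveV.
  by rewrite gt_eqF ?d_gt0.
suff : f b <= f a.
  rewrite /f ler_pdivlMr ?d_gt0 ?ab ?lexx// mulrAC ler_pdivrMr ?d_gt0 ?ab ?lexx//.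
apply: (@ler0_derive1_le_cc _ f a b) => //.
- by move=> x; rewrite in_itv /= => /andP[/ltW ax /ltW xb]; have [] := df x _; rewrite ?ax.
- move=> x; rewrite in_itv /= => /andP[/ltW ax /ltW xb].
  have xab : a <= x <= b by rewrite ax.
  have dx := df x xab; rewrite derive1E derive_val.
  have := w_le0 x xab; have := d_gt0 x xab; rewrite hornerD hornerN !hornerM => d0 w0.
  rewrite -(pmulr_lle0 _ (exprn_gt0 2 d0)) /GRing.scale /=.
  apply: le_trans w0; rewrite le_eqVlt; apply/orP; left; apply/eqP.
  by field; rewrite gt_eqF.
- apply: derivable_within_continuous => x; rewrite in_itv /= => xab.
  by have [] := df x xab.
- by rewrite bound_itvE.
- by rewrite bound_itvE.
Qed.

(** A Legendre polynomial up to a nonzero factor. Leaving the normalisation open makes the notion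
    stable under [x -> -x]. *)
Definition legendre_like (R : realType) (N : nat) (P : {poly R}) : Prop :=
  [/\ (0 < N)%N, size P = N.+1
    & forall q : {poly R}, (size q <= N)%N -> pint (-1) 1 (P * q) = 0].

Section Legendre.
Variables (R : realType) (N : nat) (P : {poly R}).
Hypothesis P_leg : legendre_like N P.
Implicit Types (q : {poly R}) (x y : R).

Local Notation J := (pint (-1) 1).
Local Notation lam := ((N * N.+1)%:R : R).
Local Notation kap := (P.[1] ^+ 2).
Local Notation G := ((1 - 'X ^+ 2) * P^`()).

Let N_gt0 : (0 < N)%N. Proof. by case: P_leg. Qed.
Let size_P : size P = N.+1. Proof. by case: P_leg. Qed.

Lemma leg_orth q : (size q <= N)%N -> J (P * q) = 0.
Proof. by case: P_leg => _ _; exact. Qed.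

Lemma lam_ge2 : 2 <= lam.
Proof. by rewrite ler_nat; case: N N_gt0 => // n _; rewrite mulSn; lia. Qed.

(** Legendre's equation, obtained as the eigenvalue equation for the trivial bubble. *)
Lemma leg_ode : G^`() = - lam *: P.
Proof.
have al : 1%N \in [:: 0; 1]%N by [].
have E1 : jbubble R 1 1 = 1 by rewrite /jbubble subnn !expr0 mulr1.
have E2 : jweight R 1 1 = 1 - 'X ^+ 2 by rewrite /jweight; ring.
have := @jacobi_op_eigen R 1 1 al al N P.
rewrite /jacobi_op E1 E2 !mul1r size_P leqnn => /(_ isT).
rewrite /jacobi_eigen /jdeg addn0 mulnC scaleNr => <- //; first by rewrite opprK.
exact: leg_orth.
Qed.

Lemma horner_leg_ode x : G^`().[x] = - lam * P.[x].
Proof. by rewrite leg_ode hornerZ. Qed.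

(** The integral of [(P^2)' = 2 P P'] is 0 by orthogonality, [P'] having lower degree. *)
Lemma leg_end : P.[-1] ^+ 2 = kap.
Proof.
have := pint_deriv (-1) 1 (P ^+ 2).
rewrite expr2 derivM (mulrC P^`()) linearD /= leg_orth; last first.
  by apply: size_deriv_leq; rewrite size_P.
by rewrite addr0 !hornerM -!expr2 => /eqP; rewrite eq_sym subr_eq0 => /eqP.
Qed.

(** Sonin's function of Legendre's equation. Its derivative is [2 x P'^2], so it falls on [[-1, 0]]
    and rises on [[0, 1]]; at the ends it equals [lam P^2]. *)
Definition sonin : {poly R} := lam *: P ^+ 2 + (1 - 'X ^+ 2) * P^`() ^+ 2.

Lemma deriv_sonin : sonin^`() = 2 *: ('X * P^`() ^+ 2).
Proof.
have : G^`() = - lam *: P := leg_ode.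
have -> : sonin^`() = 2 * P^`() * (G^`() + lam *: P) + 2 *: ('X * P^`() ^+ 2).
  by rewrite /sonin -!mul_polyC !poly.derivE /= !polyCMn; ring.
by move=> ->; rewrite scaleNr addNr mulr0 add0r.
Qed.

Lemma horner_sonin x : sonin.[x] = lam * P.[x] ^+ 2 + (1 - x ^+ 2) * P^`().[x] ^+ 2.
Proof. by rewrite /sonin !hornE. Qed.

Lemma sonin_max a b x : a <= x <= b -> sonin.[x] <= Num.max sonin.[a] sonin.[b].
Proof.
move=> /andP[ax xb]; rewrite le_max; apply/orP.
have [x0|x0] := leP 0 x; [right|left].
  apply: poly_homo => // y /andP[xy _]; rewrite deriv_sonin !hornE.
  by have y0 := le_trans x0 xy; rewrite mulr_ge0// mulr_ge0// sqr_ge0.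
rewrite -lerN2 -!hornerN; apply: poly_homo => // y /andP[_ yx].
have y0 : y <= 0 by rewrite (le_trans yx)// ltW.
rewrite derivN deriv_sonin !hornE.
by have := mulr_le0_ge0 y0 (sqr_ge0 P^`().[y]); lra.
Qed.

Let lam_gt0 : 0 < lam. Proof. by have := lam_ge2; lra. Qed.

Lemma leg_le x : -1 <= x <= 1 -> P.[x] ^+ 2 <= kap.
Proof.
move=> x1; have := sonin_max x1; rewrite !horner_sonin leg_end sqrrN expr1n subrr.
rewrite !mul0r !addr0 maxxx => H.
have : 0 <= (1 - x ^+ 2) * P^`().[x] ^+ 2 by rewrite mulr_ge0 ?sqr_ge0//; nra.
by move=> H2; rewrite -(ler_pM2l lam_gt0); lra.
Qed.

Lemma kap_gt0 : 0 < kap.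
Proof.
rewrite lt_neqAle sqr_ge0 andbT eq_sym; apply/eqP => k0.
have : P = 0.
  apply: (@eq0_poly_itv _ _ (-1) 1) => [|x x1]; first by lra.
  by apply/eqP; rewrite -sqrf_eq0 eq_le sqr_ge0 andbT -k0 leg_le.
by move=> P0; have := size_P; rewrite P0 size_poly0.
Qed.

(** The mean value theorem for [P] on [[x, 1]], and then for [G] on [[c, 1]], gives
    [P'(c) (1 + c) = lam P(d)], where [P(d)^2 <= kap]. *)
Lemma leg_near1 x : 0 <= x <= 1 -> kap * (1 - lam * (1 - x)) <= P.[1] * P.[x].
Proof.
move=> /andP[x0]; rewrite le_eqVlt => /predU1P[->|x1].
  by rewrite subrr mulr0 subr0 mulr1 expr2.
have [c /itvP cx E] := poly_mvt P x1.
have c1 : c < 1 by rewrite cx.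
have xc : x < c by rewrite cx.
have [d /itvP dc E2] := poly_mvt G c1.
have cd : c < d < 1 by rewrite !dc.
have d1 : -1 <= d <= 1 by lra.
move: E2; rewrite horner_leg_ode !hornE expr1n subrr mul0r sub0r => E2.
have {}E2 : (1 + c) * P^`().[c] = lam * P.[d].
  have c0 : 1 - c != 0 by rewrite subr_eq0 gt_eqF.
  by apply: (mulIf c0); lra.
have Pd := leg_le d1; have k0 := kap_gt0; have l0 := lam_gt0.
have s1 : P.[1] * P.[d] <= kap.
  have := sqr_ge0 (P.[1] - P.[d]); nra.
have s2 : P.[1] * P^`().[c] <= lam * kap.
  have : (1 + c) * (P.[1] * P^`().[c]) <= lam * kap.
    by rewrite mulrCA E2 mulrCA ler_pM2l.
  have [|H] := leP (P.[1] * P^`().[c]) 0; first by have := mulr_gt0 l0 k0; lra.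
  nra.
have -> : P.[x] = P.[1] - P^`().[c] * (1 - x) by rewrite -E; ring.
have x1' : 0 <= 1 - x by rewrite subr_ge0 ltW.
have := ler_wpM2r x1' s2; lra.
Qed.

(** By Rolle's theorem for [G], [P] has a zero between [x] and 1, and [leg_near1] keeps zeros at
    distance at least [1 / lam] from 1. *)
Lemma leg_node_right x : -1 < x < 1 -> P^`().[x] = 0 -> 1 <= lam * (1 - x).
Proof.
move=> /andP[x1 x2] P'x; have l2 := lam_ge2; have k0 := kap_gt0.
have [x0|x0] := ltP x 0; first by nra.
have Gx : G.[x] = G.[1] by rewrite !hornE P'x expr1n subrr mulr0 mul0r.
have [y /itvP yx] := poly_rolle x2 Gx; rewrite horner_leg_ode => E.
have Py : P.[y] = 0 by move/eqP: E; rewrite mulf_eq0 oppr_eq0 gt_eqF //= => /eqP.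
have xy : x < y by rewrite yx.
have y01 : 0 <= y <= 1 by rewrite yx (le_trans x0)// ltW.
have := leg_near1 y01; rewrite Py mulr0 pmulr_rle0// => H.
nra.
Qed.

Definition sonin_den : {poly R} := (4 * lam + 1) *: (1 - 'X ^+ 2) + 1.
Definition sonin_num : {poly R} :=
  sonin_den * P ^+ 2 + (2 *: G - 'X * P) ^+ 2.

(* With [x = cos t], the Liouville substitution [Y = P (cos t) sqrt (sin t)] turns
   Legendre's equation into [Y'' + Q Y = 0], [4 (sin t)^2 Q = sonin_den], and
   [(1 - x^2) (sonin_num / sonin_den)^2] is the square of Sonin's function
   [Y^2 + Y'^2 / Q], which is monotone because [Q] is. *)
Lemma sonin2_antitone x y : 0 <= x -> x <= y -> y <= 1 ->
  ((1 - 'X ^+ 2) * sonin_num ^+ 2).[y] * (sonin_den ^+ 2).[x] <=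
  ((1 - 'X ^+ 2) * sonin_num ^+ 2).[x] * (sonin_den ^+ 2).[y].
Proof.
move=> x0 xy y1; have l0 := lam_gt0.
have den_gt0 z : 0 <= z <= 1 -> 0 < sonin_den.[z].
  move=> z01; have z2 : 0 <= 1 - z ^+ 2 by nra.
  by rewrite /sonin_den !hornE; have := mulr_ge0 (ltW l0) z2; lra.
apply: poly_quot_antitone => // z /andP[xz zy].
  by rewrite horner_exp exprn_gt0// den_gt0// (le_trans x0)// (le_trans zy).
have z01 : 0 <= z <= 1 by rewrite (le_trans x0)// (le_trans zy).
set n := (1 - 'X ^+ 2) * sonin_num ^+ 2.
have -> : (n^`() * sonin_den ^+ 2 - n * (sonin_den ^+ 2)^`()) =
  - 4 *: (sonin_num * sonin_den * 'X * (2 *: G - 'X * P) ^+ 2).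
  rewrite /n /sonin_num.
  move: leg_ode; rewrite /sonin_den.
  (* Naming [G] prevents the product from being differentiated, so that Legendre's equation can be
     inserted. *)
  have [g gE] : exists g, g = G by exists G.
  rewrite -gE => E.
  rewrite !poly.derivE E /= -!mul_polyC !(polyCM, polyCD, polyCN). rewrite gE; ring.
rewrite hornerZ mulNr oppr_le0 mulr_ge0//.
have num_ge0 : 0 <= sonin_num.[z].
  rewrite /sonin_num hornerD horner_exp hornerM horner_exp addr_ge0 ?sqr_ge0//.
  by rewrite mulr_ge0 ?sqr_ge0 ?(ltW (den_gt0 _ z01)).
rewrite hornerM horner_exp hornerM hornerX hornerM mulr_ge0 ?sqr_ge0//.
by rewrite mulr_ge0 ?(le_trans x0 xz)// mulr_ge0// ltW// den_gt0.
Qed.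

End Legendre.

(** * Values of Legendre polynomials at the nodes and gaps between nodes *)

Section LegendreNodes.
Variables (R : realType) (N : nat) (P : {poly R}).
Hypothesis P_leg : legendre_like N P.

Local Notation J := (pint (-1) 1).
Local Notation lam := ((N * N.+1)%:R : R).
Local Notation kap := (P.[1] ^+ 2).
Local Notation G := ((1 - 'X ^+ 2) * P^`()).
Implicit Types x y : R.

(* Sonin's function at [x] is compared with its value at [1 - 1 / (2 * lam)], where
   [P] is still at least half of [P.[1]]. *)
Lemma leg_node_value_right x : 0 <= x < 1 -> P^`().[x] = 0 ->
  kap ^+ 2 <= 128 * lam * (1 - x ^+ 2) * P.[x] ^+ 4.
Proof.
move=> /andP[x0 x1] P'x.
have l2 := lam_ge2 P_leg; have k0 := kap_gt0 P_leg.
have nx : 1 <= lam * (1 - x).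
  by apply: (leg_node_right P_leg) => //; lra.
have near1 := leg_near1 P_leg.
have anti y : x <= y <= 1 -> _ := fun H => sonin2_antitone P_leg x0 (andP H).1 (andP H).2.
have denE z : (sonin_den R N).[z] = (4 * lam + 1) * (1 - z ^+ 2) + 1.
  by rewrite /sonin_den !hornE.
move: l2 nx near1 denE; set l : R := lam => l2 nx near1 denE.
clearbody l.
set k := P.[1] ^+ 2 in k0 *.
pose y := 1 - (2 * l)^-1.
have l0 : l != 0 by rewrite gt_eqF//; lra.
have ly : l * (1 - y) = 2^-1 by rewrite /y; field.
have xy : x <= y by nra.
have y1 : y <= 1 by nra.
have Py : k ^+ 2 <= 16 * P.[y] ^+ 4.
  have y01 : 0 <= y <= 1 by lra.
  have := near1 _ y01; rewrite ly -/k => H.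
  have H2 : k / 2 <= P.[1] * P.[y] by lra.
  have H3 : (k / 2) ^+ 2 <= k * P.[y] ^+ 2.
    by rewrite -exprMn ler_sqr ?nnegrE; lra.
  have H4 : k <= 4 * P.[y] ^+ 2 by rewrite -(ler_pM2l k0); lra.
  have -> : 16 * P.[y] ^+ 4 = (4 * P.[y] ^+ 2) ^+ 2 by ring.
  by rewrite ler_sqr ?nnegrE//; lra.
have := anti y; rewrite xy y1 => /(_ isT).
rewrite !(hornerM, horner_exp).
set d := (sonin_den R N).[x]; set e := (sonin_den R N).[y].
have D z : 0 <= z <= 1 -> 1 <= (sonin_den R N).[z].
  move=> z01; have z2 : 0 <= 1 - z ^+ 2 by nra.
  have lp : 0 <= l by lra.
  by rewrite denE; have := mulr_ge0 lp z2; lra.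
have d1 : 1 <= d by apply: D; lra.
have e1 : 1 <= e by apply: D; lra.
have -> : (1 - 'X ^+ 2).[x] = 1 - x ^+ 2 by rewrite !hornE.
have -> : (1 - 'X ^+ 2).[y] = 1 - y ^+ 2 by rewrite !hornE.
(* At [y] the square in [sonin_num] is dropped; at the critical point [x] it reduces to
   [x^2 P(x)^2], at most [d P(x)^2] since [d >= 1]. *)
have nyE : e * P.[y] ^+ 2 <= (sonin_num N P).[y].
  by rewrite /sonin_num hornerD hornerM !horner_exp -/e lerDl sqr_ge0.
have nxE : 0 <= (sonin_num N P).[x] <= 2 * d * P.[x] ^+ 2.
  rewrite /sonin_num hornerD hornerM !horner_exp -/d !hornE P'x !mulr0 sub0r sqrrN exprMn.
  have := sqr_ge0 P.[x]; have : x ^+ 2 <= 1 by nra.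
  have := sqr_ge0 x; nra.
move: nyE nxE; set n := (sonin_num N P).[x]; set n' := (sonin_num N P).[y].
move=> nyE /andP[n0 nxE] H.
have s1 : (1 - y ^+ 2) * (e * P.[y] ^+ 2) ^+ 2 * d ^+ 2 <=
          (1 - x ^+ 2) * (2 * d * P.[x] ^+ 2) ^+ 2 * e ^+ 2.
  apply: le_trans (le_trans H _).
    rewrite ler_wpM2r ?sqr_ge0// ler_wpM2l//; first by nra.
    have q0 : 0 <= e * P.[y] ^+ 2 by rewrite mulr_ge0 ?sqr_ge0//; lra.
    by rewrite ler_sqr// nnegrE// (le_trans q0).
  rewrite ler_wpM2r ?sqr_ge0// ler_wpM2l//; first by nra.
  by rewrite ler_sqr ?nnegrE//; apply: le_trans nxE.
have s2 : (1 - y ^+ 2) * P.[y] ^+ 4 <= 4 * (1 - x ^+ 2) * P.[x] ^+ 4.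
  have de : 0 < (d * e) ^+ 2 by rewrite exprn_gt0// mulr_gt0//; lra.
  rewrite -(ler_pM2l de); lra.
(* As [l (1 - y) = 1 / 2], the factor [2 l (1 - y^2)] equals [1 + y]. The constant 128 arises as
   [16 * 2 * 4]. *)
have s3 : P.[y] ^+ 4 <= 2 * l * ((1 - y ^+ 2) * P.[y] ^+ 4).
  have P4 : 0 <= P.[y] ^+ 4 by rewrite (_ : 4%N = (2 * 2)%N)// exprM sqr_ge0.
  have y2 : 1 <= 2 * l * (1 - y ^+ 2) by nra.
  by rewrite mulrA ler_peMl.
have s4 : 2 * l * ((1 - y ^+ 2) * P.[y] ^+ 4) <=
          2 * l * (4 * (1 - x ^+ 2) * P.[x] ^+ 4).
  by rewrite ler_wpM2l//; lra.
lra.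
Qed.

(* [P] vanishes between the two nodes by Rolle's theorem for [G], and Sonin's
   function bounds [P^`()] by the larger of the values of [P] at the two nodes. *)
Lemma leg_gap x y : -1 <= x -> x < y -> y <= 1 -> G.[x] = 0 -> G.[y] = 0 ->
  Num.min (1 - x ^+ 2) (1 - y ^+ 2) <= lam * (y - x) ^+ 2.
Proof.
move=> x1 xy y1 Gx Gy; have l2 := lam_ge2 P_leg; have k0 := kap_gt0 P_leg.
have [z /itvP zxy] := poly_rolle xy (etrans Gx (esym Gy)).
rewrite (horner_leg_ode P_leg) => /eqP.
rewrite mulf_eq0 oppr_eq0 gt_eqF /=; last by lra.
move=> /eqP Pz.
have soninG t : G.[t] = 0 -> (sonin N P).[t] = lam * P.[t] ^+ 2.
  rewrite hornerM; have -> : (1 - 'X ^+ 2).[t] = 1 - t ^+ 2 by rewrite !hornE.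
  by move=> Gt; rewrite horner_sonin [X in _ + _ * X]expr2 (mulrA (1 - t ^+ 2)) Gt mul0r addr0.
pose a := if P.[x] ^+ 2 <= P.[y] ^+ 2 then y else x.
have aM t : x <= t <= y -> (sonin N P).[t] <= lam * P.[a] ^+ 2.
  move=> /(sonin_max P_leg); rewrite (soninG x)// (soninG y)// -maxr_pMr; last by lra.
  by rewrite /a; case: (leP (P.[x] ^+ 2)).
have Pa : 0 < P.[a] ^+ 2.
  rewrite lt_neqAle sqr_ge0 andbT eq_sym; apply/eqP => Pa0.
  have : P = 0.
    apply: (eq0_poly_itv xy) => t txy.
    have := aM t txy; rewrite horner_sonin Pa0 mulr0 => H.
    have : 0 <= (1 - t ^+ 2) * P^`().[t] ^+ 2 by rewrite mulr_ge0 ?sqr_ge0//; nra.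
    move=> H2; have H3 : lam * P.[t] ^+ 2 <= 0 by lra.
    apply/eqP; rewrite -sqrf_eq0 eq_le sqr_ge0 andbT.
    by rewrite pmulr_rle0 in H3 => //; lra.
  by move=> P0; move: k0; rewrite P0 horner0 expr0n ltxx.
have [c cxy Pac] : exists2 c, x <= c <= y & P.[a] ^+ 2 <= (P^`().[c] * (y - x)) ^+ 2.
  have xz : x < z by rewrite zxy.
  have zy : z < y by rewrite zxy.
  rewrite /a; case: ifP => _.
    have [c /itvP cz E] := poly_mvt P zy; exists c.
      by rewrite !ltW ?cz ?(lt_trans xz) ?cz.
    move: E; rewrite Pz subr0 => ->; rewrite !exprMn ler_wpM2l ?sqr_ge0//.
    by rewrite ler_sqr ?nnegrE; lra.
  have [c /itvP cz E] := poly_mvt P xz; exists c.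
    by rewrite !ltW ?cz ?(lt_trans _ zy) ?cz.
  move: E; rewrite Pz sub0r => /eqP; rewrite eqr_oppLR => /eqP ->.
  rewrite sqrrN !exprMn ler_wpM2l ?sqr_ge0//.
  by rewrite ler_sqr ?nnegrE; lra.
have c2 : Num.min (1 - x ^+ 2) (1 - y ^+ 2) <= 1 - c ^+ 2.
  rewrite ge_min; have [c0|c0] := leP 0 c; apply/orP; [right|left]; nra.
apply: le_trans c2 _.
have := aM c cxy; rewrite horner_sonin => H.
have H1 : (1 - c ^+ 2) * P^`().[c] ^+ 2 <= lam * P.[a] ^+ 2.
  by have := mulr_ge0 (ler0n R (N * N.+1)) (sqr_ge0 P.[c]); lra.
have c1 : 0 <= 1 - c ^+ 2 by nra.
have H2 := ler_wpM2l c1 Pac.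
have H3 := ler_wpM2r (sqr_ge0 (y - x)) H1.
rewrite -(ler_pM2r Pa); apply: le_trans H2 _.
by rewrite exprMn mulrA; apply: le_trans H3 _; rewrite mulrAC.
Qed.

End LegendreNodes.

(** * Reflection to the left half of the interval *)

Lemma pint_opp (R : rcfType) (p : {poly R}) :
  pint (-1) 1 (p \Po (- 'X)) = pint (-1) 1 p.
Proof.
have -> : p \Po (- 'X) = - (primitive p \Po (- 'X))^`().
  by rewrite deriv_comp deriv_primitive derivN derivX mulrN1 opprK.
rewrite linearN /= pint_deriv !horner_comp !hornerN !hornerX opprK.
by rewrite /pint opprB.
Qed.

Lemma legendre_like_opp (R : realType) (N : nat) (P : {poly R}) :
  legendre_like N P -> legendre_like N (P \Po (- 'X)).
Proof.
have sizeX (q : {poly R}) : size (q \Po (- 'X)) = size q.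
  by rewrite size_comp_poly2// size_polyN size_polyX.
move=> [N0 sP oP]; split=> // [|q sq]; first by rewrite sizeX.
rewrite -pint_opp comp_polyM -comp_polyA.
by rewrite raddfN /= comp_polyX opprK comp_polyXr oP// sizeX.
Qed.

Section LegendreNodesSym.
Variables (R : realType) (N : nat) (P : {poly R}).
Hypothesis P_leg : legendre_like N P.

Local Notation lam := ((N * N.+1)%:R : R).
Local Notation kap := (P.[1] ^+ 2).
Local Notation G := ((1 - 'X ^+ 2) * P^`()).
Implicit Types x y : R.
Local Notation Q := (P \Po (- 'X)).

Let Q_leg : legendre_like N Q. Proof. exact: legendre_like_opp. Qed.

Let QE x : Q.[- x] = P.[x].
Proof. by rewrite horner_comp hornerN hornerX opprK. Qed.

Let Q'E x : Q^`().[- x] = - P^`().[x].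
Proof.
by rewrite deriv_comp derivN derivX mulrN1 hornerN horner_comp hornerN hornerX opprK.
Qed.

Lemma leg_node_left x : -1 < x < 1 -> P^`().[x] = 0 -> 1 <= lam * (1 + x).
Proof.
move=> x1 P'x; rewrite -[x]opprK.
by apply: (leg_node_right Q_leg); [lra|rewrite Q'E P'x oppr0].
Qed.

Lemma leg_node_value x : -1 < x < 1 -> P^`().[x] = 0 ->
  kap ^+ 2 <= 128 * lam * (1 - x ^+ 2) * P.[x] ^+ 4.
Proof.
move=> x1 P'x; have [x0|x0] := leP 0 x.
  by apply: (leg_node_value_right P_leg) => //; lra.
have := leg_node_value_right Q_leg (_ : 0 <= - x < 1).
by rewrite QE -(leg_end Q_leg) QE Q'E P'x oppr0 sqrrN; apply=> //; lra.
Qed.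

Lemma leg_node_dist x : -1 < x < 1 -> P^`().[x] = 0 -> 1 <= lam * (1 - x ^+ 2).
Proof.
move=> x1 P'x; have l2 := lam_ge2 P_leg.
have := leg_node_left x1 P'x; have := leg_node_right P_leg x1 P'x.
by have [x0|x0] := leP 0 x; nra.
Qed.

(** The minimum in [leg_gap] is replaced by its value at [x]. If [1 - y^2] is less than a quarter of
    [1 - x^2], then [y - x >= 3/8 (1 - x^2)], and [lam (1 - x^2) >= 1] suffices. *)
Lemma leg_node_gap x y : -1 < x -> x < y -> y <= 1 -> P^`().[x] = 0 -> G.[y] = 0 ->
  9 * (1 - x ^+ 2) <= 64 * lam * (y - x) ^+ 2.
Proof.
move=> x1 xy y1 P'x Gy; have l2 := lam_ge2 P_leg.
have x11 : -1 < x < 1 by lra.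
have dx := leg_node_dist x11 P'x.
have Gx : G.[x] = 0 by rewrite hornerM P'x mulr0.
have := leg_gap P_leg (ltW x1) xy y1 Gx Gy.
have x2 : 0 < 1 - x ^+ 2 by nra.
have [s|s] := leP ((1 - x ^+ 2) / 4) (1 - y ^+ 2).
  rewrite ge_min => /orP[]; first by lra.
  by have := le_trans s; move=> /[apply]; lra.
move=> _.
have h : 3 / 8 * (1 - x ^+ 2) <= y - x by nra.
have : (3 / 8 * (1 - x ^+ 2)) ^+ 2 <= (y - x) ^+ 2 by rewrite ler_sqr ?nnegrE; lra.
have l0 : 0 <= lam by lra.
move=> /(ler_wpM2l l0).
have := ler_wpM2r (ltW x2) dx; lra.
Qed.

End LegendreNodesSym.

(** * Gauss-Lobatto quadrature *)

(** Repeated integration by parts in Rodrigues' formula: derivatives of order below [N] still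
    contain the factor [x^2 - 1], so no boundary term survives. *)
Lemma legendre_like_legendre (R : realType) (N : nat) : (0 < N)%N ->
  legendre_like N (legendre R N).
Proof.
move=> N0; pose F : {poly R} := ('X^2 - 1) ^+ N.
have sizeF : size F = (2 * N).+1.
  have F0 : F != 0 by rewrite expf_neq0// -polyC1 -size_poly_gt0 size_XnsubC.
  have := size_exp ('X^2 - 1 : {poly R}) N; rewrite -/F -polyC1 size_XnsubC// => <-.
  by rewrite prednK// size_poly_gt0.
have dY : ('X^2 - 1 : {poly R})^`() = 2 * 'X.
  by rewrite derivB derivXn derivC subr0 /= expr1 mulr_natl.
have dvdF k : (k <= N)%N -> exists g, F^`(k) = ('X^2 - 1) ^+ (N - k) * g.
  elim: k => [|k IH] kN; first by exists 1; rewrite subn0 mulr1.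
  have [g gE] := IH (ltnW kN); rewrite derivnS gE.
  rewrite -(subnSK kN); exists ((N - k.+1).+1%:R * g * (2 * 'X) + ('X^2 - 1) * g^`()).
  rewrite derivM deriv_exp /= dY (exprS _ (N - k.+1)).
  rewrite -[X in X * g]mulr_natl; move: (_ ^+ (N - k.+1)) (_%:R) => y c; ring.
have derivnF (k : nat) (q : {poly R}) : (k <= N)%N -> (size q <= k)%N ->
    pint (-1) 1 (F^`(k) * q) = 0.
  elim: k q => [|k IH] q kN sq.
    by move: sq; rewrite size_poly_leq0 => /eqP ->; rewrite mulr0 linear0.
  have [g gE] := dvdF k (ltnW kN).
  have z x : x ^+ 2 = 1 -> F^`(k).[x] = 0.
    move=> x2; rewrite gE hornerM horner_exp !hornerE x2 subrr.
    by rewrite expr0n subn_eq0 leqNgt kN mul0r.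
  rewrite derivnS pint_parts !z ?sqrrN ?expr1n// !mul0r subrr sub0r.
  by rewrite IH ?oppr0// ?(ltnW kN)// size_deriv_leq.
have c0 : ((2 ^ N * N`!)%:R : R) != 0.
  by rewrite pnatr_eq0 -lt0n muln_gt0 expn_gt0 fact_gt0.
split=> // [|q sq]; last first.
  by rewrite /legendre -scalerAl linearZ /= derivnF// mulr0.
rewrite /legendre size_scale ?invr_eq0//.
have sd (p : {poly R}) (n : nat) : size p^`(n) = (size p - n)%N.
  elim: n => [|n IH]; first by rewrite subn0.
  by rewrite derivnS subnS -IH size_deriv.
by rewrite -/F sd sizeF; lia.
Qed.

Section Quadrature.
Variables (R : realType) (N : nat) (P : {poly R}) (xi : 'I_N.+1 -> R).
Hypothesis P_leg : legendre_like N P.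
Hypothesis xi_inj : injective xi.
Local Notation G := ((1 - 'X ^+ 2) * P^`()).
Hypothesis xi_root : forall i, G.[xi i] = 0.
Implicit Types (f g q : {poly R}).

Local Notation J := (pint (-1) 1).
Local Notation lam := ((N * N.+1)%:R : R).
Local Notation kap := (P.[1] ^+ 2).

Definition gl_weight i : R :=
  J (\prod_(j < N.+1 | j != i) ((xi i - xi j)^-1 *: ('X - (xi j)%:P))).

Let N_gt0 : (0 < N)%N. Proof. by case: P_leg. Qed.
Let size_P : size P = N.+1. Proof. by case: P_leg. Qed.

Lemma size_derivP : size P^`() = N.
Proof. by rewrite size_deriv// size_P. Qed.

Lemma size_G : size G = N.+2.
Proof.
rewrite size_mul -?size_poly_gt0 ?size_derivP ?N_gt0//.
  by rewrite -opprB size_polyN size_XnsubC.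
by rewrite -opprB size_polyN size_XnsubC.
Qed.

(** Division by [G] leaves a remainder that is its own interpolant. The multiple of [G] integrates
    to 0: by parts it becomes the product of [P] with a polynomial of degree below [N]. *)
Lemma gl_quadrature f : (size f <= N.*2)%N ->
  J f = \sum_i gl_weight i * f.[xi i].
Proof.
move=> sf; pose r := f %% G; pose q := f %/ G.
have fE : f = q * G + r by exact: divp_eq.
have G0 : G != 0 by rewrite -size_poly_gt0 size_G.
have sr : (size r <= N.+1)%N by rewrite -ltnS -size_G ltn_modp.
have sq : (size q <= N.-1)%N.
  by rewrite size_divp// size_G; move: sf; rewrite -addnn; move: (size f) => k; lia.
have -> : J f = J r.
  rewrite fE linearD /=; suff -> : J (q * G) = 0 by rewrite add0r.
  rewrite mulrA (mulrC _ P^`()) pint_parts !hornerM.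
  have -> : (1 - 'X ^+ 2 : {poly R}).[1] = 0 by rewrite !hornE expr1n subrr.
  have -> : (1 - 'X ^+ 2 : {poly R}).[-1] = 0 by rewrite !hornE sqrrN expr1n subrr.
  rewrite !mulr0 subrr sub0r (leg_orth P_leg) ?oppr0//.
  apply: size_deriv_leq; rewrite (leq_trans (size_polyMleq _ _))//.
  have s2 : size (1 - 'X ^+ 2 : {poly R}) = 3 by rewrite -opprB size_polyN size_XnsubC.
  by rewrite s2; move: sq; move: (size q) N_gt0 => k; lia.
have rE : r = lagrange_interp xi (horner r) by exact: lagrange_interp_unique.
rewrite {1}rE /lagrange_interp linear_sum; apply: eq_bigr => i _.
rewrite linearZ /= mulrC -/(gl_weight i); congr (_ * _).
by rewrite fE hornerD hornerM xi_root mulr0 add0r.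
Qed.

Lemma gl_quadrature1 f i : (size f <= N.*2)%N ->
  (forall j, j != i -> f.[xi j] = 0) -> J f = gl_weight i * f.[xi i].
Proof.
move=> sf fz; rewrite gl_quadrature// (bigD1 i) //= big1 ?addr0// => j ji.
by rewrite fz// mulr0.
Qed.

Lemma xi_cases i : (xi i = 1) + (xi i = -1) + (P^`().[xi i] = 0).
Proof.
have := xi_root i; rewrite hornerM => /eqP; rewrite mulf_eq0.
case: (eqVneq (xi i) 1) => [->|x1]; first by left; left.
case: (eqVneq (xi i) (-1)) => [->|x2]; first by left; right.
move=> /orP H; right; case: H => /eqP //.
rewrite !hornE => /eqP; rewrite subr_eq0 eq_sym sqrf_eq1.
by rewrite (negbTE x1) (negbTE x2).
Qed.

(* At an interior node [x], the quadrature rule applied to [(1 - 'X ^+ 2) * t ^+ 2],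
   with [t = P^`() / ('X - x)], has a single nonzero term, and the integral is
   computed by parts; at an end, the same holds of [(1 + 'X) * P^`()] or
   [(1 - 'X) * P^`()]. *)
Lemma gl_weightE i : gl_weight i * (lam * P.[xi i] ^+ 2) = 2 * kap.
Proof.
have dG : G^`() = (1 - 'X ^+ 2) * P^`()^`() - 2 *: ('X * P^`()).
  by rewrite !poly.derivE /= expr1 -mul_polyC polyCMn; ring.
(* At the ends the second derivative drops out of Legendre's equation. *)
have dP1 : 2 * P^`().[1] = lam * P.[1].
  have := horner_leg_ode P_leg 1; rewrite dG !hornE expr1n subrr; lra.
have dPm1 : 2 * P^`().[-1] = - (lam * P.[-1]).
  have := horner_leg_ode P_leg (-1); rewrite dG !hornE sqrrN expr1n subrr; lra.
have J0 q : (size q <= N)%N -> J (P * q) = 0 by exact: leg_orth.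
have J1 : J P = 0 by rewrite -(mulr1 P) J0// size_poly1.
have [[xi1|xi1]|P'xi] := xi_cases i.
- rewrite xi1; suff H : gl_weight i * (2 * P^`().[1]) = 2 * P.[1].
    transitivity (gl_weight i * (lam * P.[1]) * P.[1]); first by ring.
    by rewrite -dP1 H; ring.
  have := @gl_quadrature1 ((1 + 'X) * P^`()) i; rewrite xi1.
  have -> : ((1 + 'X) * P^`()).[1] = 2 * P^`().[1] by rewrite !hornE.
  move=> <-.
  + rewrite mulrC pint_parts !poly.derivE add0r mulr1 J1 !hornE; ring.
  + rewrite (leq_trans (size_polyMleq _ _))// size_derivP.
    have -> : size (1 + 'X : {poly R}) = 2 by rewrite addrC -polyC1 size_XaddC.
    by rewrite -addnn; lia.
  + move=> j ji; have : xi j != 1 by rewrite -xi1 inj_eq.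
    case: (xi_cases j) => [[->|->]|P'j] x1; rewrite !hornE ?eqxx// in x1 *.
    * by rewrite subrr mul0r.
    * by rewrite P'j mulr0.
- rewrite xi1; suff H : gl_weight i * (2 * P^`().[-1]) = - 2 * P.[-1].
    rewrite -(leg_end P_leg).
    transitivity (- (gl_weight i * - (lam * P.[-1])) * P.[-1]); first by ring.
    by rewrite -dPm1 H; ring.
  have := @gl_quadrature1 ((1 - 'X) * P^`()) i; rewrite xi1.
  have -> : ((1 - 'X) * P^`()).[-1] = 2 * P^`().[-1] by rewrite !hornE opprK.
  move=> <-.
  + rewrite mulrC pint_parts !poly.derivE sub0r mulrN1 linearN /= J1 !hornE; ring.
  + rewrite (leq_trans (size_polyMleq _ _))// size_derivP.
    have -> : size (1 - 'X : {poly R}) = 2 by rewrite -opprB size_polyN -polyC1 size_XsubC.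
    by rewrite -addnn; lia.
  + move=> j ji; have : xi j != -1 by rewrite -xi1 inj_eq.
    case: (xi_cases j) => [[->|->]|P'j] x1; rewrite !hornE ?eqxx// in x1 *.
    * by rewrite subrr mul0r.
    * by rewrite P'j mulr0.
set x := xi i in P'xi *.
have [t tE] : exists t, P^`() = t * ('X - x%:P) by apply/factor_theorem/rootP.
have t0 : t != 0.
  by apply/eqP => t0; have := size_derivP; rewrite tE t0 mul0r size_poly0; move: N_gt0; lia.
have st : size t = N.-1.
  by have := size_derivP; rewrite tE size_Mmonic ?monicXsubC// size_XsubC addn2 /= => <-.
have tx : t.[x] = P^`()^`().[x].
  by rewrite tE derivM hornerD !hornerM !poly.derivE !hornE subrr mulr0 add0r mulr1.
have x2t : (1 - x ^+ 2) * t.[x] = - lam * P.[x].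
  by rewrite tx -(horner_leg_ode P_leg) derivM hornerD !hornerM P'xi mulr0 add0r !hornE.
have tend y : t.[y] * (y - x) = P^`().[y] by rewrite tE !hornE.
pose f := (1 - 'X ^+ 2) * t ^+ 2.
have Jf : J f = 2 * (P.[1] * t.[1] + P.[-1] * t.[-1]).
  have -> : f = 2 *: (P^`() * ('X * t)) - (2 * lam) *: (P * t) - (G * t)^`().
    have E := leg_ode P_leg.
    have E2 : P^`()^`() = t^`() * ('X - x%:P) + t by rewrite tE !poly.derivE mulr1.
    have E3 : (1 - 'X ^+ 2) * P^`()^`() = 2 *: ('X * P^`()) - lam *: P.
      by rewrite -scaleNr -E dG [RHS]addrC subrK.
    have -> : (G * t)^`() = - lam *: P * t + G * t^`() by rewrite derivM E.
    have -> : G * t^`() = t * ((1 - 'X ^+ 2) * P^`()^`()) - f.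
      by rewrite E2 /f {1}tE; ring.
    rewrite E3 -!mul_polyC !(polyCM, polyCN, polyCMn); ring.
  rewrite !pintB !pintZ J0; last by rewrite st leq_pred.
  rewrite pint_deriv !hornerM.
  have -> : (1 - 'X ^+ 2 : {poly R}).[1] = 0 by rewrite !hornE expr1n subrr.
  have -> : (1 - 'X ^+ 2 : {poly R}).[-1] = 0 by rewrite !hornE sqrrN expr1n subrr.
  rewrite pint_parts J0; first by rewrite !hornE; ring.
  rewrite size_deriv_leq// mulrC size_mulX// st; lia.
have := @gl_quadrature1 f i; rewrite Jf -/x => H.
have {}H : 2 * (P.[1] * t.[1] + P.[-1] * t.[-1]) = gl_weight i * ((1 - x ^+ 2) * t.[x] ^+ 2).
  rewrite H; first by rewrite /f !hornE.
    rewrite /f (leq_trans (size_polyMleq _ _))//.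
    have -> : size (1 - 'X ^+ 2 : {poly R}) = 3 by rewrite -opprB size_polyN size_XnsubC.
    have := size_polyMleq t t; rewrite -expr2 st -addnn; move: N_gt0 (size (t ^+ 2)) => n0 k; lia.
  move=> j ji; rewrite /f hornerM horner_exp.
  case: (xi_cases j) => [[->|->]|P'j].
  - by rewrite !hornE expr1n subrr mul0r.
  - by rewrite !hornE sqrrN expr1n subrr mul0r.
  have : t.[xi j] * (xi j - x) = 0 by rewrite tend.
  move=> /eqP; rewrite mulf_eq0 subr_eq0 inj_eq// (negbTE ji) orbF => /eqP ->.
  by rewrite expr0n mulr0.
(* Multiplication by [1 - x^2] allows [(1 - x^2) t(x) = - lam P(x)] to be used. *)
have {}H : 2 * (1 - x ^+ 2) * (P.[1] * t.[1] + P.[-1] * t.[-1]) =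
    gl_weight i * (lam * P.[x]) ^+ 2.
  have -> : (lam * P.[x]) ^+ 2 = ((1 - x ^+ 2) * t.[x]) ^+ 2 by rewrite x2t mulNr sqrrN.
  by rewrite mulrAC H; ring.
have l0 : lam != 0 by rewrite gt_eqF// (lt_le_trans _ (lam_ge2 P_leg))// ltr0n.
apply: (mulfI l0); have <- : gl_weight i * (lam * P.[x]) ^+ 2 =
    lam * (gl_weight i * (lam * P.[x] ^+ 2)) by ring.
rewrite -H.
have e1 : 2 * ((1 - x) * t.[1]) = lam * P.[1] by rewrite -dP1 -tend; ring.
have e2 : 2 * ((1 + x) * t.[-1]) = lam * P.[-1].
  by apply: oppr_inj; rewrite -dPm1 -tend; ring.
transitivity ((1 + x) * P.[1] * (2 * ((1 - x) * t.[1])) +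
              (1 - x) * P.[-1] * (2 * ((1 + x) * t.[-1]))); first by ring.
rewrite e1 e2.
transitivity (lam * ((1 + x) * P.[1] ^+ 2 + (1 - x) * P.[-1] ^+ 2)); first by ring.
by rewrite (leg_end P_leg); ring.
Qed.

Lemma leg_node_neq0 i : 0 < P.[xi i] ^+ 2.
Proof.
rewrite lt_neqAle sqr_ge0 andbT eq_sym; apply/eqP => P0.
by have := gl_weightE i; have := kap_gt0 P_leg; rewrite P0 !mulr0; lra.
Qed.

Lemma gl_weight_gt0 i : 0 < gl_weight i.
Proof.
have l2 := lam_ge2 P_leg.
rewrite -(pmulr_lgt0 _ (_ : 0 < lam * P.[xi i] ^+ 2)).
  by rewrite gl_weightE mulr_gt0// (kap_gt0 P_leg).
by rewrite mulr_gt0 ?leg_node_neq0//; lra.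
Qed.

(** Degree [2 N] is one too many for exactness. With [f = a P + g] and [g] of degree below [N], only
    [P^2] is not integrated exactly; adding [(1 - x^2) P'^2], which vanishes at the nodes, to
    [N^2 P^2] cancels the top coefficient. *)
Lemma gl_quadrature_sqr f : (size f <= N.+1)%N ->
  J (f ^+ 2) <= \sum_i gl_weight i * f.[xi i] ^+ 2.
Proof.
move=> sf; pose a := f`_N / P`_N; pose g := f - a *: P.
have PN : P`_N != 0 by rewrite -[N in _`_N]/(N.+1.-1) -size_P lead_coef_eq0 -size_poly_gt0 size_P.
have sg : (size g <= N)%N.
  apply/leq_sizeP => i; rewrite leq_eqVlt => /predU1P[<-|ni].
    by rewrite coefB coefZ divfK// subrr.
  by rewrite coefB coefZ !nth_default ?mulr0 ?subr0// ?size_P// (leq_trans sf).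
have Pg : \sum_i gl_weight i * (P * g).[xi i] = 0.
  rewrite -gl_quadrature ?(leg_orth P_leg)//.
  by rewrite (leq_trans (size_polyMleq _ _))// size_P -addnn; move: sg; lia.
have gg : J (g ^+ 2) = \sum_i gl_weight i * (g ^+ 2).[xi i].
  by rewrite gl_quadrature// (leq_trans (size_polyMleq _ _))// -addnn; move: sg; lia.
have PP : N%:R ^+ 2 * (\sum_i gl_weight i * (P ^+ 2).[xi i]) =
    (lam + N%:R ^+ 2) * J (P ^+ 2).
  pose h := (1 - 'X ^+ 2) * P^`() ^+ 2 + N%:R ^+ 2 *: P ^+ 2.
  have Jh : J h = (lam + N%:R ^+ 2) * J (P ^+ 2).
    rewrite /h pintD pintZ expr2 mulrA (mulrC _ P^`()) pint_parts (leg_ode P_leg).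
    have -> : G.[1] = 0 by rewrite hornerM !hornE expr1n subrr mul0r.
    have -> : G.[-1] = 0 by rewrite hornerM !hornE sqrrN expr1n subrr mul0r.
    by rewrite -scalerAr pintZ -expr2; ring.
  rewrite -Jh gl_quadrature.
    rewrite mulr_sumr; apply: eq_bigr => i _.
    have hG : (1 - 'X ^+ 2) * P^`() ^+ 2 = G * P^`() by rewrite expr2 mulrA.
    rewrite /h hG hornerD hornerZ (hornerM G) xi_root mul0r add0r; ring.
  have -> : h = (N%:R *: P - 'X * P^`()) * (N%:R *: P + 'X * P^`()) + P^`() ^+ 2.
    by rewrite /h -!mul_polyC; ring.
  have s1 : (size (N%:R *: P - 'X * P^`())%R <= N)%N.
    apply/leq_sizeP => i; rewrite coefB coefZ coef_euler.
    rewrite leq_eqVlt => /predU1P[<-|ni]; first by rewrite subrr.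
    by rewrite nth_default ?mulr0 ?subr0// size_P.
  have s2 : (size (N%:R *: P + 'X * P^`())%R <= N.+1)%N.
    apply/leq_sizeP => i ni; rewrite coefD coefZ coef_euler.
    by rewrite nth_default ?mulr0 ?addr0// size_P.
  rewrite (leq_trans (size_polyD _ _))// geq_max; apply/andP; split.
    by rewrite (leq_trans (size_polyMleq _ _))// -addnn; move: s1 s2; lia.
  by rewrite (leq_trans (size_polyMleq _ _))// size_derivP -addnn; lia.
set S := \sum_i _ in PP.
have SP : J (P ^+ 2) <= S.
  have N2 : 0 < N%:R ^+ 2 :> R by rewrite exprn_gt0// ltr0n.
  have JP : 0 <= J (P ^+ 2).
    by apply: pint_ge0 => [|x _]; [lra|rewrite horner_exp sqr_ge0].
  rewrite -(ler_pM2l N2) PP ler_wpM2r// lerDr; exact: ler0n.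
have fE : f = a *: P + g by rewrite addrC subrK.
have -> : J (f ^+ 2) = a ^+ 2 * J (P ^+ 2) + J (g ^+ 2).
  have -> : f ^+ 2 = a ^+ 2 *: P ^+ 2 + (2 * a) *: (P * g) + g ^+ 2.
    by rewrite fE -!mul_polyC !(polyCM, polyCMn, polyC_exp) -/(2%:R); ring.
  by rewrite !pintD !pintZ (leg_orth P_leg)// mulr0 addr0.
have -> : \sum_i gl_weight i * f.[xi i] ^+ 2 = a ^+ 2 * S + J (g ^+ 2).
  transitivity (\sum_i (a ^+ 2 * (gl_weight i * (P ^+ 2).[xi i]) +
      2 * a * (gl_weight i * (P * g).[xi i]) + gl_weight i * (g ^+ 2).[xi i])).
    by apply: eq_bigr => i _; rewrite fE !horner_exp hornerM hornerD hornerZ; ring.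
  by rewrite !big_split /= -!mulr_sumr Pg mulr0 addr0 -gg.
by rewrite lerD2r ler_wpM2l ?sqr_ge0.
Qed.

End Quadrature.

(** * Estimate at the nodes *)

Section BubbleBounds.
Variables (R : realType) (al be : nat).
Hypotheses (al01 : al \in [:: 0; 1]%N) (be01 : be \in [:: 0; 1]%N).
Implicit Types (x t : R).
Local Notation w := (jweight R al be).
Local Notation b := (jbubble R al be).

Lemma jweight_le4 t : -1 <= t <= 1 -> w.[t] <= 4.
Proof.
move=> t1; rewrite horner_jweight; move: al01 be01; rewrite !inE.
by move=> /orP[] /eqP -> /orP[] /eqP ->; rewrite ?expr0 ?expr1; nra.
Qed.

Lemma jbubble_le4 t : -1 <= t <= 1 -> b.[t] <= 4.
Proof.
move=> t1; rewrite horner_jbubble; move: al01 be01; rewrite !inE.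
by move=> /orP[] /eqP -> /orP[] /eqP ->; rewrite ?subnn ?subn0 ?expr0 ?expr1; nra.
Qed.

(** A step of [(1 - x^2) / 4] is at most half the distance to either end, so the linear factors
    change only by a bounded ratio. *)
Lemma jweight_jbubble_near x t : -1 < x < 1 -> x <= t <= x + (1 - x ^+ 2) / 4 ->
  w.[x] <= 2 * w.[t] /\ b.[t] <= 3 / 2 * b.[x].
Proof.
move=> x1 xt; have [t1 t2] : (1 - x) <= 2 * (1 - t) /\ (1 + t) <= 3 / 2 * (1 + x) by split; nra.
have t3 : 0 < 1 - x by lra.
have t4 : 0 < 1 + x by lra.
rewrite /jweight /jbubble !hornE; move: al01 be01; rewrite !inE.
by move=> /orP[] /eqP -> /orP[] /eqP ->; rewrite ?subnn ?subn0 ?expr0 ?expr1; split; nra.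
Qed.

(** Bernstein polynomials take the values of [u] at the ends, hence are divisible by the bubble
    here; [1 - x^2 = w b] in their error supplies the factor [b]. *)
Lemma jbubble_density (u : R -> R) (L eps : R) :
  (forall s t : R, -1 <= s <= 1 -> -1 <= t <= 1 ->
    (u s - u t) ^+ 2 <= L * (s - t) ^+ 2) ->
  (al = 0%N -> u 1 = 0) -> (be = 0%N -> u (-1) = 0) -> 0 < eps ->
  exists chi : {poly R}, forall t, -1 <= t <= 1 ->
    (u t - b.[t] * chi.[t]) ^+ 2 <= eps * b.[t].
Proof.
move=> uL u1 um1 eps0; have L0 : 0 <= L.
  have := uL 1 0; rewrite subr0 expr1n mulr1 => H.
  by apply: le_trans (H _ _); rewrite ?sqr_ge0//; lra.
pose n := Num.bound (4 * L / eps).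
have Ln : 4 * L / eps < n%:R.
  by apply: archi_boundP; rewrite divr_ge0 ?mulr_ge0// ltW.
have n0 : 0 < n%:R :> R by apply: le_lt_trans Ln; rewrite divr_ge0 ?mulr_ge0// ltW.
pose g (k : nat) := u (2 * k%:R / n%:R - 1).
have [||chi chiE] := @jbubble_factor R al be al01 be01 (bernstein n g).
- by move=> a0; rewrite bernstein_right /g mulfK ?gt_eqF// -u1//; congr u; lra.
- by move=> b0; rewrite bernstein_left /g mulr0 mul0r sub0r um1.
exists chi => t t1; rewrite -hornerM -chiE -sqrrN opprB.
apply: le_trans (bernstein_approx t1 uL _) _; first by rewrite -(ltr0n R).
rewrite -(horner_jweight_bubble al01 be01) ler_pdivrMr//.
have b0 := jbubble_ge0 al be t1.
have h1 : L * (w.[t] * b.[t]) <= 4 * L * b.[t].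
  by have := ler_wpM2l (mulr_ge0 L0 b0) (jweight_le4 t1); lra.
apply: le_trans h1 _; rewrite [leRHS]mulrAC ler_wpM2r//.
by move: Ln; rewrite ltr_pdivrMr// (mulrC n%:R) => /ltW.
Qed.

End BubbleBounds.

(** [poly_trace] with [V^2 <= 2 (b zeta)^2 + 2 eps b], where one factor [b] is traded for
    [3/2 b(c)]. *)
Lemma trace_bubble (R : rcfType) (b V zeta : {poly R}) (p q c eps : R) :
  p <= c <= q -> 0 < b.[c] ->
  (forall t, p <= t <= q -> 0 <= b.[t] <= 3 / 2 * b.[c]) ->
  (forall t, p <= t <= q -> (V.[t] - b.[t] * zeta.[t]) ^+ 2 <= eps * b.[t]) ->
  0 <= eps ->
  (q - p) * V.[c] ^+ 2 / b.[c] <=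
  6 * (pint p q (b * zeta ^+ 2) + eps * (q - p)) +
  2 * ((q - p) ^+ 2 / b.[c]) * pint p q (V^`() ^+ 2).
Proof.
move=> pcq bc0 bb Vz eps0; have pq : p <= q by move: pcq => /andP[]; exact: le_trans.
rewrite ler_pdivrMr//; apply: le_trans (poly_trace V pcq) _.
have -> : (6 * (pint p q (b * zeta ^+ 2) + eps * (q - p)) +
    2 * ((q - p) ^+ 2 / b.[c]) * pint p q (V^`() ^+ 2)) * b.[c] =
  2 * ((3 * b.[c]) * pint p q (b * zeta ^+ 2) + 3 * b.[c] * eps * (q - p)) +
  2 * (q - p) ^+ 2 * pint p q (V^`() ^+ 2).
  by field; rewrite gt_eqF.
rewrite lerD2r ler_pM2l// -pintC -pintZ -pintD le_pint// => t tpq.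
have := Vz t tpq; have /andP[] := bb t tpq.
rewrite hornerD hornerZ hornerC (hornerM b) !horner_exp.
set B := b.[t]; set Bc := b.[c]; set v := V.[t]; set z := zeta.[t] => B0 BB vz.
have h1 : v ^+ 2 <= 2 * (B * z) ^+ 2 + 2 * (v - B * z) ^+ 2.
  by have := sqr_ge0 (v - 2 * (B * z)); lra.
have h2 : B * (B * z ^+ 2) <= 3 / 2 * Bc * (B * z ^+ 2).
  by rewrite ler_wpM2r// mulr_ge0 ?sqr_ge0.
have h3 := ler_wpM2l eps0 BB.
lra.
Qed.

(** * Quadrature weights, local bounds and their sum over the nodes *)

Section MainEstimate.
Variables (R : realType) (al be : nat).
Hypotheses (al01 : al \in [:: 0; 1]%N) (be01 : be \in [:: 0; 1]%N).
Variables (N : nat) (P : {poly R}) (xi : 'I_N.+1 -> R).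
Hypothesis P_leg : legendre_like N P.
Hypotheses (xi_first : xi ord0 = -1) (xi_last : xi ord_max = 1).
Hypothesis xi_lt : forall i j : 'I_N.+1, (i < j)%N -> xi i < xi j.
Local Notation G := ((1 - 'X ^+ 2) * P^`()).
Hypothesis xi_root : forall i, G.[xi i] = 0.

Local Notation J := (pint (-1) 1).
Local Notation w := (jweight R al be).
Local Notation b := (jbubble R al be).
Local Notation lam := ((N * N.+1)%:R : R).
Local Notation omega := (gl_weight xi).

Let N_gt0 : (0 < N)%N. Proof. by case: P_leg. Qed.

(** The nodes indexed by [nat], as [pw] requires; meaningful for [k <= N]. *)
Definition node k : R := xi (inord k).

Local Notation x := node.

Lemma node_lt k : (k < N)%N -> x k < x k.+1.
Proof. by move=> kN; apply: xi_lt; rewrite !inordK// ltnS// ltnW. Qed.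

Lemma node_first : x 0 = -1.
Proof. by rewrite -xi_first; congr xi; apply: val_inj; rewrite /= inordK. Qed.

Lemma node_last : x N = 1.
Proof. by rewrite -xi_last; congr xi; apply: val_inj; rewrite /= inordK. Qed.

Lemma node_ord (i : 'I_N.+1) : x i = xi i.
Proof. by rewrite /node inord_val. Qed.

Lemma xi_inj : injective xi.
Proof.
move=> i j E; apply: val_inj => /=.
by have [/xi_lt|/xi_lt|//] := ltngtP i j; rewrite E ltxx.
Qed.

Lemma node_itv k : (k <= N)%N -> -1 <= x k <= 1.
Proof.
by move=> kN; rewrite -{1}node_first -node_last !(node_le node_lt)//= kN ?leqnn.
Qed.

Lemma node_interior k : (0 < k < N)%N -> -1 < x k < 1.
Proof.
move=> /andP[k0 kN]; rewrite -{1}node_first -node_last; apply/andP; split.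
  by apply: xi_lt; rewrite !inordK// ltnS ltnW.
by apply: xi_lt; rewrite !inordK// ltnS ltnW.
Qed.

Lemma node_deriv k : (0 < k < N)%N -> P^`().[x k] = 0.
Proof.
move=> kN; have /andP[k1 k2] := node_interior kN.
have := xi_cases xi_root (inord k); rewrite -/(node k).
by move=> [[H|H]|//]; move: k1 k2; rewrite H ltxx.
Qed.

Lemma node_dist k : (0 < k < N)%N -> 1 <= lam * (1 - x k ^+ 2).
Proof. by move=> kN; apply: (leg_node_dist P_leg); rewrite ?node_interior ?node_deriv. Qed.

(** Square [gl_weightE] and insert the lower bound of [leg_node_value]; [512 = 4 * 128]. *)
Lemma weight_interior_le k : (0 < k < N)%N ->
  omega (inord k) ^+ 2 <= 512 * (1 - x k ^+ 2) / lam.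
Proof.
move=> kN; have := gl_weightE P_leg xi_inj xi_root (inord k).
have := leg_node_value P_leg (node_interior kN) (node_deriv kN).
have l2 := lam_ge2 P_leg; have k0 := kap_gt0 P_leg.
have := leg_node_neq0 P_leg xi_inj xi_root (inord k).
rewrite -/(node k); move: l2; set l : R := lam; set o := omega _; set X := 1 - _.
move: (P.[1] ^+ 2) k0 => K K0; clearbody l o X => l2 P0 H E.
have p0 : 0 < P.[x k] ^+ 4 by rewrite (_ : 4%N = (2 * 2)%N)// exprM exprn_gt0.
have lp : 0 < l by lra.
rewrite ler_pdivlMr// -(ler_pM2r (mulr_gt0 lp p0)).
have -> : o ^+ 2 * l * (l * P.[x k] ^+ 4) = (o * (l * P.[x k] ^+ 2)) ^+ 2 by ring.
by rewrite E; lra.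
Qed.

(** Length of the interval to the right of the node on which the trace inequality is applied: short
    enough for the next cell and for [b] and [w] to vary little, yet comparable to the quadrature
    weight. *)
Definition reach k : R := Num.sqrt ((1 - x k ^+ 2) / lam) / 4.

Lemma reachP k : (0 < k < N)%N ->
  [/\ 0 < reach k, 16 * lam * reach k ^+ 2 = 1 - x k ^+ 2,
      reach k <= (1 - x k ^+ 2) / 4, reach k <= x k.+1 - x k
    & omega (inord k) <= 100 * reach k].
Proof.
move=> kN; have d := node_dist kN; have wl := weight_interior_le kN.
have o0 := gl_weight_gt0 P_leg xi_inj xi_root (inord k).
have gap : 9 * (1 - x k ^+ 2) <= 64 * lam * (x k.+1 - x k) ^+ 2.
  have /andP[k0 k1] := kN; have /andP[x1 x2] := node_interior kN.
  apply: (leg_node_gap P_leg) => //; rewrite ?node_deriv ?node_lt//.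
    by have /andP[] := node_itv k1.
  exact: xi_root.
have h : 0 < x k.+1 - x k by rewrite subr_gt0 node_lt//; case/andP: kN.
have l2 := lam_ge2 P_leg.
rewrite /reach; move: l2 d wl gap; set l : R := lam; set X := 1 - _.
set o := omega _ in o0 *; set hh := x k.+1 - x k in h *; clearbody l X o hh.
move=> l2 d wl gap.
have lp : 0 < l by lra.
have X0 : 0 < X by rewrite -(pmulr_rgt0 _ lp); lra.
have Xl : 0 < X / l by rewrite divr_gt0.
set r := Num.sqrt (X / l).
have r0 : 0 < r by rewrite sqrtr_gt0.
have r2 : r ^+ 2 = X / l by rewrite sqr_sqrtr// ltW.
have r2l : l * r ^+ 2 = X by rewrite r2 mulrC divfK// gt_eqF.
split.
- by rewrite divr_gt0.
- by rewrite -r2l; field.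
- have : r ^+ 2 <= X ^+ 2.
    rewrite r2 ler_pdivrMr//; have := ler_wpM2l (ltW X0) d; lra.
  by rewrite ler_sqr ?nnegrE; lra.
- have : (3 * r) ^+ 2 <= (8 * hh) ^+ 2.
    by rewrite -(ler_pM2l lp) !exprMn; lra.
  by rewrite ler_sqr ?nnegrE; lra.
- have : o ^+ 2 <= (25 * r) ^+ 2.
    by rewrite exprMn r2; apply: le_trans wl _; lra.
  by rewrite ler_sqr ?nnegrE; lra.
Qed.


Variables (U : nat -> {poly R}) (d : nat -> R).
Hypothesis U_deriv : forall k, (k < N)%N -> (U k)^`() = (d k)%:P.
Hypothesis U_cont : forall k, (k.+1 < N)%N -> (U k).[x k.+1] = (U k.+1).[x k.+1].
Hypothesis U_right : al = 0%N -> (U N.-1).[1] = 0.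
Hypothesis U_left : be = 0%N -> (U 0%N).[-1] = 0.
Hypothesis U_dense : forall eps : R, 0 < eps -> exists chi : {poly R},
  forall k t, (k < N)%N -> x k <= t <= x k.+1 ->
    ((U k).[t] - b.[t] * chi.[t]) ^+ 2 <= eps * b.[t].

Local Notation E := (energy al be N x U).
(** The number of terms for which [z], a multiple of [b], has degree at most [N]. *)
Local Notation n := (N.+1 - jdeg al be)%N.
Local Notation z := (jacobi_proj al be N x U n).
Local Notation V k := (U k - z).

Let x_lt k : (k < N)%N -> x k < x k.+1. Proof. exact: node_lt. Qed.
Let x0 : x 0 = -1. Proof. exact: node_first. Qed.
Let xN : x N = 1. Proof. exact: node_last. Qed.
Let x_inj : injective xi. Proof. exact: xi_inj. Qed.
Let b_ge0 (t : R) : -1 <= t <= 1 -> 0 <= b.[t]. Proof. exact: jbubble_ge0. Qed.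
Let w_ge0 (t : R) : -1 <= t <= 1 -> 0 <= w.[t]. Proof. exact: jweight_ge0. Qed.
Let wb t : w.[t] * b.[t] = 1 - t ^+ 2. Proof. exact: horner_jweight_bubble. Qed.

Let cell_itv k t : (k < N)%N -> x k <= t <= x k.+1 -> -1 <= t <= 1.
Proof.
move=> kN /andP[kt tk]; apply/andP; split.
  by apply: le_trans kt; have /andP[] := node_itv (ltnW kN).
by apply: le_trans tk _; have /andP[] := node_itv kN.
Qed.

Let jdeg_le2 : (jdeg al be <= 2)%N.
Proof. by rewrite /jdeg; lia. Qed.

Let size_z : (size z <= N.+1)%N.
Proof.
by rewrite (leq_trans (size_proj al01 be01 _ _ _ _))// subnKC// (leq_trans jdeg_le2).
Qed.

Lemma energy_ge0 : 0 <= E.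
Proof.
apply: (pw_ge0 x_lt) => k t kN /(cell_itv kN) t1.
by rewrite hornerM horner_exp mulr_ge0 ?sqr_ge0 ?w_ge0.
Qed.

Lemma energy_z : J (w * z^`() ^+ 2) <= E.
Proof. exact: energy_proj_le. Qed.

Lemma energy_V : pw N x (fun k => w * (V k)^`() ^+ 2) <= 4 * E.
Proof.
apply: (@le_trans _ _ (pw N x (fun k => 2 *: (w * (U k)^`() ^+ 2) + 2 *: (w * z^`() ^+ 2)))).
  apply: (le_pw x_lt) => k t kN /(cell_itv kN) t1.
  rewrite derivB hornerD !hornerZ !(hornerM w) !horner_exp hornerD hornerN.
  have := mulr_ge0 (w_ge0 t1) (sqr_ge0 ((U k)^`().[t] + z^`().[t])); lra.
rewrite pwD pwZ pwZ pw_poly x0 xN -/E; have := energy_z; lra.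
Qed.

(** [trace_bubble] on an interval of length [reach k]: the weight is at most 100 times this length,
    and [16 lam (reach k)^2 / b = w] at the node turns the derivative term into weighted energy. *)
Lemma interior_bound (zeta : {poly R}) (eps : R) k : (0 < k < N)%N -> 0 <= eps ->
  (forall t, x k <= t <= x k.+1 ->
    ((V k).[t] - b.[t] * zeta.[t]) ^+ 2 <= eps * b.[t]) ->
  lam * (omega (inord k) * (V k).[x k] ^+ 2 / b.[x k]) <=
  600 * lam * (pint (x k) (x k.+1) (b * zeta ^+ 2) + eps * (x k.+1 - x k)) +
  25 * pint (x k) (x k.+1) (w * (V k)^`() ^+ 2).
Proof.
move=> kN eps0 Vz; have /andP[k0 k1] := kN.
have xk := node_interior kN.
have [r0 r2 r1 rx wr] := reachP kN.
set r := reach k in r0 r2 r1 rx wr *.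
have bk : 0 < b.[x k].
  rewrite lt_neqAle b_ge0 ?andbT; last by lra.
  by apply/eqP => b0; have := wb (x k); rewrite -b0 mulr0; nra.
have cell t : x k <= t <= x k + r -> x k <= t <= x k.+1 by lra.
have near t : x k <= t <= x k + r -> w.[x k] <= 2 * w.[t] /\ b.[t] <= 3 / 2 * b.[x k].
  by move=> t1; apply: jweight_jbubble_near => //; lra.
have := @trace_bubble R b (V k) zeta (x k) (x k + r) (x k) eps.
have -> : x k + r - x k = r by ring.
move=> /(_ _ bk _ _ eps0) H.
have {}H : r * (V k).[x k] ^+ 2 / b.[x k] <=
    6 * (pint (x k) (x k + r) (b * zeta ^+ 2) + eps * r) +
    2 * (r ^+ 2 / b.[x k]) * pint (x k) (x k + r) ((V k)^`() ^+ 2).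
  apply: H => [|t tk|t tk]; first by lra.
  - by rewrite b_ge0 ?(cell_itv k1 (cell t tk))//; have [] := near t tk.
  - exact/Vz/cell.
have l2 := lam_ge2 P_leg.
have rb : 16 * lam * (r ^+ 2 / b.[x k]) = w.[x k].
  by rewrite mulrA r2 -wb mulfK// gt_eqF.
have h1 : w.[x k] * pint (x k) (x k + r) ((V k)^`() ^+ 2) <=
          2 * pint (x k) (x k.+1) (w * (V k)^`() ^+ 2).
  apply: (@le_trans _ _ (2 * pint (x k) (x k + r) (w * (V k)^`() ^+ 2))).
    rewrite -!pintZ le_pint// => [|t tk]; first by lra.
    have [wt _] := near t tk.
    rewrite !hornerZ (hornerM w) !horner_exp [leRHS]mulrA.
    by rewrite ler_wpM2r ?sqr_ge0.
  rewrite ler_pM2l//; apply: pint_itvS => //; [by lra|by lra|].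
  move=> t tk; rewrite hornerM horner_exp mulr_ge0 ?sqr_ge0//.
  exact/w_ge0/(cell_itv k1).
have h2 : pint (x k) (x k + r) (b * zeta ^+ 2) <= pint (x k) (x k.+1) (b * zeta ^+ 2).
  apply: pint_itvS => //; [by lra|by lra|].
  move=> t tk; rewrite hornerM horner_exp mulr_ge0 ?sqr_ge0//.
  exact/b_ge0/(cell_itv k1).
have h3 : eps * r <= eps * (x k.+1 - x k) by rewrite ler_wpM2l//; lra.
have v0 : 0 <= (V k).[x k] ^+ 2 / b.[x k] by rewrite divr_ge0 ?sqr_ge0 ?ltW.
have h4 : omega (inord k) * (V k).[x k] ^+ 2 / b.[x k] <=
    100 * (r * (V k).[x k] ^+ 2 / b.[x k]).
  by have := ler_wpM2r v0 wr; lra.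
have lp : 0 < lam by lra.
move: rb h1 h2 h3 h4 H l2 lp.
set A1 := pint _ _ ((V k)^`() ^+ 2); set A2 := pint _ (x k + r) (b * _).
set A3 := pint _ (x k.+1) (b * _); set A4 := pint _ _ (w * _).
set q := r ^+ 2 / _; set o := omega _ * _ / _; set o2 := r * _ / _.
set ee := eps * r; set e2 := eps * (_ - _).
move: (lam) (w.[x k]) => l W rb h1 h2 h3 h4 H l2 lp.
clearbody A1 A2 A3 A4 q o o2 ee e2.
have h5 : l * o <= 100 * (l * (6 * (A2 + ee) + 2 * q * A1)).
  by have := ler_wpM2l (ltW lp) (le_trans h4 (ler_wpM2l (ler0n R 100) H)); lra.
have h6 : l * (A2 + ee) <= l * (A3 + e2) by rewrite ler_pM2l//; lra.
have h7 : 16 * l * q * A1 <= 2 * A4 by rewrite rb.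
lra.
Qed.

(** Serves both ends, [c] being the end. The unweighted norm of [V'] on [[p, q]] is split: [z'] is
    handled by [schur_inequality], while [U'] is constant on the cell and [w] has integral at least
    [(q - p)^2 / 2]. *)
Lemma endpoint_bound (zeta : {poly R}) (eps : R) k p q c (o : R) :
  (k < N)%N -> 0 <= eps -> x k <= p -> q <= x k.+1 -> p <= c <= q ->
  lam * (q - p) = 1 -> lam * o = 2 -> 1 <= b.[c] ->
  (forall t, p <= t <= q -> b.[t] <= 3 / 2 * b.[c]) ->
  (q - p) ^+ 2 / 2 <= pint p q w ->
  (forall t, x k <= t <= x k.+1 ->
    ((V k).[t] - b.[t] * zeta.[t]) ^+ 2 <= eps * b.[t]) ->
  lam * (o * (V k).[c] ^+ 2 / b.[c]) <=
  12 * lam * (pint (x k) (x k.+1) (b * zeta ^+ 2) + eps * (x k.+1 - x k)) + 96 * E.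
Proof.
move=> kN eps0 xp qx pcq lpq lo bc bt wpq Vz.
have l2 := lam_ge2 P_leg; have lp : 0 < lam by lra.
have pq : p <= q by lra.
have cell t : p <= t <= q -> x k <= t <= x k.+1 by lra.
have H : (q - p) * (V k).[c] ^+ 2 / b.[c] <=
    6 * (pint p q (b * zeta ^+ 2) + eps * (q - p)) +
    2 * ((q - p) ^+ 2 / b.[c]) * pint p q ((V k)^`() ^+ 2).
  apply: trace_bubble => // [|t tpq|t tpq]; first by lra.
  - by rewrite b_ge0 ?bt// (cell_itv kN (cell t tpq)).
  - exact/Vz/cell.
have h2 : pint p q (b * zeta ^+ 2) <= pint (x k) (x k.+1) (b * zeta ^+ 2).
  apply: pint_itvS => // t tk; rewrite hornerM horner_exp mulr_ge0 ?sqr_ge0//.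
  exact/b_ge0/(cell_itv kN).
have h3 : eps * (q - p) <= eps * (x k.+1 - x k) by rewrite ler_wpM2l//; lra.
have hz : pint p q (z^`() ^+ 2) <= 10 * lam * E.
  have p1 : -1 <= p by have /andP[] := @cell_itv k p kN ltac:(lra).
  have q1 : q <= 1 by have /andP[] := @cell_itv k q kN ltac:(lra).
  apply: (@le_trans _ _ (J (z^`() ^+ 2))).
    by apply: pint_itvS => // t _; rewrite horner_exp sqr_ge0.
  (* The bound for degree [N] is used, although [z'] has smaller degree, because its constant is
     [lam]; then [4 (3 + lam) <= 10 lam]. *)
  have sz : (size z^`() <= N.+1)%N.
    by rewrite (leq_trans (size_deriv_leq size_z)).
  apply: le_trans (schur_inequality sz) _.
  have s1 : J ((1 - 'X ^+ 2) * z^`() ^+ 2) <= 4 * E.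
    apply: le_trans (_ : 4 * J (w * z^`() ^+ 2) <= _); last first.
      by rewrite ler_pM2l//; exact: energy_z.
    rewrite -pintZ le_pint// => t t1.
    rewrite hornerZ hornerM (hornerM w) horner_exp.
    have -> : (1 - 'X ^+ 2).[t] = w.[t] * b.[t] by rewrite wb !hornE.
    rewrite [leRHS]mulrA ler_wpM2r ?sqr_ge0// mulrC ler_wpM2r ?w_ge0//.
    exact: jbubble_le4.
  have l3 : 0 <= 3 + lam by lra.
  have := ler_wpM2l l3 s1; have := ler_wpM2r energy_ge0 l2; lra.
have hu : pint p q ((U k)^`() ^+ 2) <= 2 * lam * E.
  have s1 : d k ^+ 2 * pint p q w <= E.
    apply: (@le_trans _ _ (pint (x k) (x k.+1) (w * (U k)^`() ^+ 2))).
      rewrite -pintZ; have -> : w * (U k)^`() ^+ 2 = d k ^+ 2 *: w.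
        by rewrite U_deriv// -mul_polyC polyC_exp mulrC.
      apply: pint_itvS => // t tk; rewrite hornerZ mulr_ge0 ?sqr_ge0//.
      exact/w_ge0/(cell_itv kN).
    rewrite /energy /pw (bigD1 (Ordinal kN)) //= lerDl sumr_ge0// => i _.
    apply: pint_ge0 => [|t ti]; first exact/ltW/x_lt.
    rewrite hornerM horner_exp mulr_ge0 ?sqr_ge0//.
    exact/w_ge0/(cell_itv (ltn_ord i)).
  have s2 : d k ^+ 2 * ((q - p) ^+ 2 / 2) <= E.
    by apply: le_trans s1; rewrite ler_wpM2l ?sqr_ge0.
  rewrite U_deriv// -polyC_exp pintC.
  have := ler_wpM2l (ltW lp) s2.
  have -> : lam * (d k ^+ 2 * ((q - p) ^+ 2 / 2)) = d k ^+ 2 * (q - p) / 2 * (lam * (q - p)).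
    by field.
  by rewrite lpq; lra.
have hV : pint p q ((V k)^`() ^+ 2) <= 24 * lam * E.
  apply: (@le_trans _ _ (2 * pint p q ((U k)^`() ^+ 2) + 2 * pint p q (z^`() ^+ 2))).
    rewrite -!pintZ -pintD le_pint// => t _.
    rewrite derivB hornerD !hornerZ !horner_exp hornerD hornerN.
    have := sqr_ge0 ((U k)^`().[t] + z^`().[t]); lra.
  lra.
have hb : lam * (2 * ((q - p) ^+ 2 / b.[c]) * pint p q ((V k)^`() ^+ 2)) <= 48 * E.
  have bc' : (b.[c])^-1 <= 1 by rewrite invf_le1//; lra.
  have E0 := energy_ge0.
  have s : (b.[c])^-1 * (24 * E) <= 24 * E by rewrite ler_piMl//; lra.
  have s2 : 0 <= 2 * (q - p) / b.[c] by rewrite divr_ge0 ?mulr_ge0//; lra.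
  have -> : lam * (2 * ((q - p) ^+ 2 / b.[c]) * pint p q ((V k)^`() ^+ 2)) =
     (2 * (q - p) / b.[c]) * pint p q ((V k)^`() ^+ 2) * (lam * (q - p)).
    by field; rewrite gt_eqF//; lra.
  rewrite lpq mulr1; apply: le_trans (ler_wpM2l s2 hV) _.
  have -> : 2 * (q - p) / b.[c] * (24 * lam * E) = 2 * (b.[c]^-1 * (24 * E)) * (lam * (q - p)).
    by field; rewrite gt_eqF//; lra.
  by rewrite lpq; lra.
have -> : lam * (o * (V k).[c] ^+ 2 / b.[c]) =
    (lam * o) * ((lam * (q - p)) * (V k).[c] ^+ 2 / b.[c]).
  by rewrite lpq mul1r !mulrA.
rewrite lo.
have -> : 2 * (lam * (q - p) * (V k).[c] ^+ 2 / b.[c]) =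
    2 * lam * ((q - p) * (V k).[c] ^+ 2 / b.[c]).
  by rewrite !mulrA.
have H2 := ler_wpM2l (ltW lp) H.
have h6 : lam * (pint p q (b * zeta ^+ 2) + eps * (q - p)) <=
  lam * (pint (x k) (x k.+1) (b * zeta ^+ 2) + eps * (x k.+1 - x k)).
  by rewrite ler_pM2l// lerD.
lra.
Qed.

Let b_right : al = 1%N -> 1 <= b.[1].
Proof.
move=> ->; rewrite /jbubble subnn expr0 mul1r !hornE.
by rewrite exprn_ege1//; lra.
Qed.

Let b_left : be = 1%N -> 1 <= b.[-1].
Proof.
move=> ->; rewrite /jbubble subnn expr0 mulr1 !hornE opprK.
by rewrite exprn_ege1//; lra.
Qed.

Let b_right0 : al = 0%N -> b.[1] = 0.
Proof. by move=> ->; rewrite /jbubble subn0 expr1 !hornE subrr mul0r. Qed.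

Let b_left0 : be = 0%N -> b.[-1] = 0.
Proof. by move=> ->; rewrite /jbubble subn0 expr1 !hornE addrN mulr0. Qed.

Let lam_omega i : P.[xi i] ^+ 2 = P.[1] ^+ 2 -> lam * omega i = 2.
Proof.
move=> Pi; have := gl_weightE P_leg x_inj xi_root i; rewrite Pi.
have k0 := kap_gt0 P_leg => H; apply: (mulIf (lt0r_neq0 k0)); rewrite -H; ring.
Qed.

Let bound_ge0 (zeta : {poly R}) (eps : R) k : (k < N)%N -> 0 <= eps ->
  0 <= 12 * lam * (pint (x k) (x k.+1) (b * zeta ^+ 2) + eps * (x k.+1 - x k)) + 96 * E.
Proof.
move=> kN eps0; have xk := x_lt kN; have l2 := lam_ge2 P_leg.
apply: addr_ge0; last by rewrite mulr_ge0// energy_ge0.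
apply: mulr_ge0; first by lra.
apply: addr_ge0; last by rewrite mulr_ge0//; lra.
apply: pint_ge0 => [|t tx]; first exact: ltW.
by rewrite hornerM horner_exp mulr_ge0 ?sqr_ge0// b_ge0// (cell_itv kN).
Qed.

Lemma left_bound (zeta : {poly R}) (eps : R) : 0 <= eps ->
  (forall k t, (k < N)%N -> x k <= t <= x k.+1 ->
    ((V k).[t] - b.[t] * zeta.[t]) ^+ 2 <= eps * b.[t]) ->
  lam * (omega ord0 * (V 0).[x 0] ^+ 2 / b.[x 0]) <=
  12 * lam * (pint (x 0) (x 1) (b * zeta ^+ 2) + eps * (x 1 - x 0)) + 96 * E.
Proof.
move=> eps0 Vz; have l2 := lam_ge2 P_leg.
have lp : 0 < lam by lra.
have [be0|be1] : be = 0%N \/ be = 1%N.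
  by move: be01; rewrite !inE => /orP[] /eqP; [left|right].
  (* Here [b] vanishes at the end and the quotient is 0 by the convention on inverses. *)
  by rewrite {1 2}x0 b_left0// invr0 !mulr0 bound_ge0.
have li : lam^-1 <= 1 / 2 by rewrite -[lam^-1]div1r ler_pM2l// lef_pV2 ?posrE.
(* The first cell has length at least [1 / lam]: it is all of [[-1, 1]] if [N = 1], and otherwise
   ends at an interior node. *)
have lx : x 0 + lam^-1 <= x 1.
  case: (ltngtP N 1) N_gt0 => // [N1 _|N1 _]; last first.
    by move: xN; rewrite N1 => ->; rewrite x0; lra.
  have N1' : (0 < 1 < N)%N by rewrite N1.
  have := leg_node_left P_leg (node_interior N1')
     (node_deriv N1').
  rewrite mulrC -ler_pdivrMr// div1r x0 => H; by rewrite addrC lerBlDl.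
have l0 : 0 < lam^-1 by rewrite invr_gt0.
have ll : lam * lam^-1 = 1 by rewrite divff// gt_eqF.
move: (lam^-1) li lx l0 ll => il li lx l0 ll.
have b1 := b_left be1.
apply: (@endpoint_bound zeta eps 0 (x 0) (x 0 + il)) => //.
- by lra.
- by rewrite addrAC subrr add0r.
- by rewrite lam_omega// xi_first (leg_end P_leg).
- by rewrite x0.
- move=> t t1; rewrite x0 in t1 *.
  apply: (@le_trans _ _ b.[-1]); last by lra.
  rewrite be1 /jbubble subnn expr0 mulr1 !hornE opprK.
  by rewrite lerXn2r ?nnegrE; lra.
(* Since [il <= 1 / 2], here [1 - t >= 1] and [w] is at least [1 + t]. *)
- have -> : x 0 + il - x 0 = il by ring.
  have -> : il ^+ 2 / 2 = pint (x 0) (x 0 + il) (1 + 'X).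
    by rewrite pintD -polyC1 pintC pintX x0; field.
  apply: le_pint => [|t t1]; first by lra.
  rewrite x0 in t1; rewrite be1 /jweight expr1 !hornE.
  have h1 : 1 <= 1 - t by lra.
  by rewrite ler_peMl ?exprn_ege1//; lra.
- by move=> t; apply: Vz.
Qed.

Lemma right_bound (zeta : {poly R}) (eps : R) : 0 <= eps ->
  (forall k t, (k < N)%N -> x k <= t <= x k.+1 ->
    ((V k).[t] - b.[t] * zeta.[t]) ^+ 2 <= eps * b.[t]) ->
  lam * (omega ord_max * (V N.-1).[x N] ^+ 2 / b.[x N]) <=
  12 * lam * (pint (x N.-1) (x N) (b * zeta ^+ 2) + eps * (x N - x N.-1)) + 96 * E.
Proof.
move=> eps0 Vz; have l2 := lam_ge2 P_leg.
have lp : 0 < lam by lra.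
have NN : (N.-1 < N)%N by rewrite prednK.
have [al0|al1] : al = 0%N \/ al = 1%N.
  by move: al01; rewrite !inE => /orP[] /eqP; [left|right].
  have := bound_ge0 zeta NN eps0; rewrite prednK// => H.
  by rewrite {1 2}xN b_right0// invr0 !mulr0.
have li : lam^-1 <= 1 / 2 by rewrite -[lam^-1]div1r ler_pM2l// lef_pV2 ?posrE.
have lx : x N.-1 <= x N - lam^-1.
  case: (ltngtP N 1) N_gt0 => // [N1 _|N1 _]; last first.
    have -> : N.-1 = 0%N by lia.
    by rewrite xN x0; move: li; move: (lam^-1) => il; lra.
  have N1' : (0 < N.-1 < N)%N by rewrite NN andbT -ltnS prednK.
  have := leg_node_right P_leg (node_interior N1')
     (node_deriv N1').
  rewrite mulrC -ler_pdivrMr// div1r xN => H; by rewrite lerBrDl addrC -lerBrDl.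
have l0 : 0 < lam^-1 by rewrite invr_gt0.
have ll : lam * lam^-1 = 1 by rewrite divff// gt_eqF.
move: (lam^-1) li lx l0 ll => il li lx l0 ll.
have b1 := b_right al1.
have xE : x N = x N.-1.+1 by rewrite prednK.
rewrite [in leRHS]xE.
apply: (@endpoint_bound zeta eps N.-1 (x N - il) (x N)) => //.
- by rewrite xE.
- by lra.
- by rewrite opprB addrC subrK.
- by rewrite lam_omega// xi_last.
- by rewrite xN.
- move=> t t1; rewrite xN in t1 *.
  apply: (@le_trans _ _ b.[1]); last by lra.
  rewrite al1 /jbubble subnn expr0 mul1r !hornE.
  by rewrite lerXn2r ?nnegrE; lra.
- have -> : x N - (x N - il) = il by ring.
  have -> : il ^+ 2 / 2 = pint (x N - il) (x N) (1 - 'X).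
    by rewrite pintB -polyC1 pintC pintX xN; field.
  apply: le_pint => [|t t1]; first by lra.
  rewrite xN in t1; rewrite al1 /jweight expr1 !hornE.
  have h1 : 1 <= 1 + t by lra.
  by rewrite ler_peMr ?exprn_ege1//; lra.
- by move=> t; apply: Vz.
Qed.


(** * The interpolant of [V] *)

Variable phi : {poly R}.
Hypothesis phi_V : forall k, (k < N)%N -> phi.[x k] = (V k).[x k].
(** No cell starts at the last node, so the value there comes from the piece on its left. *)
Hypothesis phi_last : phi.[x N] = (V N.-1).[x N].

(** The eigenvalue is [(n + 1) (N + 1)], with [n + 1 >= N]. *)
Lemma eigen_n : lam <= jacobi_eigen R al be n.
Proof.
rewrite ler_nat; have := jdeg_le2; move: (jdeg al be) N_gt0 => m N0 m2.
have -> : (N.+1 - m + m = N.+1)%N by lia.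
by apply: leq_mul => //; lia.
Qed.

(** Each node but the last is charged to the cell on its right, the last one to the last cell. The
    approximation error [eps] is arbitrary and disappears in the limit. *)
Lemma node_sum_bound :
  lam * (\sum_i omega i * phi.[xi i] ^+ 2 / b.[xi i]) <= 1600 * E.
Proof.
have l2 := lam_ge2 P_leg; have lp : 0 < lam by lra.
have E0 := energy_ge0.
apply/ler_addgt0Pr => e e0.
(* The final sum is at most [1516 E + 3672 lam eps]. *)
pose eps := Num.min 1 (e / (4000 * lam)).
have L0 : 0 < 4000 * lam by lra.
have eps0 : 0 < eps by rewrite lt_min ltr01 divr_gt0.
have eps1 : eps <= 1 by rewrite ge_min lexx.
have epse : 4000 * lam * eps <= e.
  by rewrite mulrC -ler_pdivlMr// ge_min lexx orbT.
(* [proj_error] asks for [eps^2], the local bounds only for [eps]. *)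
have [chi chiP] := U_dense (exprn_gt0 2 eps0).
have ln0 : 0 < jacobi_eigen R al be n by apply: lt_le_trans eigen_n.
have := proj_error al01 be01 N_gt0 x_lt x0 xN U_cont U_right U_left eps0 eps1 chiP ln0.
set zeta := chi - _ => zetaJ.
have Vz k t : (k < N)%N -> x k <= t <= x k.+1 ->
    ((V k).[t] - b.[t] * zeta.[t]) ^+ 2 <= eps ^+ 2 * b.[t].
  move=> kN tk; have -> : (V k).[t] - b.[t] * zeta.[t] = (U k).[t] - b.[t] * chi.[t].
    by rewrite /zeta /jacobi_proj !hornerD !hornerN (hornerM b); ring.
  exact: chiP.
have ee : eps ^+ 2 <= eps by rewrite expr2 ler_piMl// ltW.
have {}Vz k t : (k < N)%N -> x k <= t <= x k.+1 ->
    ((V k).[t] - b.[t] * zeta.[t]) ^+ 2 <= eps * b.[t].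
  move=> kN tk; apply: le_trans (Vz k t kN tk) _.
  by rewrite ler_wpM2r// b_ge0// (cell_itv kN).
have {}zetaJ : lam * J (b * zeta ^+ 2) <= 2 * E + 4 * (lam * eps).
  have h : lam * (E / jacobi_eigen R al be n) <= E.
    by rewrite mulrCA ler_piMr// ler_pdivrMr// mul1r eigen_n.
  by have := ler_wpM2l (ltW lp) zetaJ; move: h; move: (E / _) => q; lra.
pose Z k := pint (x k) (x k.+1) (b * zeta ^+ 2) + eps * (x k.+1 - x k).
pose D k := pint (x k) (x k.+1) (w * (V k)^`() ^+ 2).
have Z0 k : (k < N)%N -> 0 <= Z k.
  move=> kN; have /ltW xk := x_lt kN; apply: addr_ge0; last first.
    by rewrite mulr_ge0 ?(ltW eps0)// subr_ge0.
  apply: pint_ge0 => // t tx.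
  by rewrite hornerM horner_exp mulr_ge0 ?sqr_ge0// b_ge0// (cell_itv kN).
have D0 k : (k < N)%N -> 0 <= D k.
  move=> kN; apply: pint_ge0 => [|t tx]; first exact/ltW/x_lt.
  by rewrite hornerM horner_exp mulr_ge0 ?sqr_ge0// w_ge0// (cell_itv kN).
have ZJ : \sum_(k < N) Z k = J (b * zeta ^+ 2) + 2 * eps.
  transitivity (pw N x (fun=> b * zeta ^+ 2 + eps%:P)).
    by apply: eq_bigr => k _; rewrite pintD pintC.
  by rewrite pw_poly x0 xN pintD pintC; ring.
have DE : \sum_(k < N) D k <= 4 * E by exact: energy_V.
have Zle k : (k < N)%N -> Z k <= J (b * zeta ^+ 2) + 2 * eps.
  move=> kN; rewrite -ZJ (bigD1 (Ordinal kN)) //= lerDl sumr_ge0// => i _.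
  exact: Z0.
have bound (k : 'I_N) : lam * (omega (inord k) * phi.[x k] ^+ 2 / b.[x k]) <=
    600 * lam * Z k + 25 * D k + (if k == 0 :> nat then 96 * E else 0).
  rewrite phi_V//; case: ifPn => [/eqP k0|k0]; last first.
    rewrite addr0; apply: interior_bound (ltW eps0) (fun t => @Vz k t (ltn_ord k)).
    by rewrite lt0n k0 /=.
  have i0 : inord k = ord0 :> 'I_N.+1 by apply: val_inj; rewrite /= k0 inordK.
  rewrite i0 k0; have := left_bound (ltW eps0) Vz.
  rewrite -/(Z 0%N); have := Z0 _ N_gt0; have := D0 _ N_gt0 => d0 z0.
  by have := mulr_ge0 (ltW lp) z0; lra.
have sumI : \sum_(k < N) (if k == 0 :> nat then 96 * E else 0) = 96 * E.
  rewrite (bigD1 (Ordinal N_gt0)) //= big1 ?addr0// => i i0.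
  by rewrite ifN//; apply: contra_neq i0 => i0; apply: val_inj.
rewrite big_ord_recr /= mulrDr.
have H1 : lam * (\sum_(k < N) omega (widen_ord (leqnSn N) k) *
      phi.[xi (widen_ord (leqnSn N) k)] ^+ 2 / b.[xi (widen_ord (leqnSn N) k)]) <=
    600 * lam * (J (b * zeta ^+ 2) + 2 * eps) + 25 * (4 * E) + 96 * E.
  rewrite mulr_sumr; apply: (@le_trans _ _ (\sum_(k < N) (600 * lam * Z k + 25 * D k +
      (if k == 0 :> nat then 96 * E else 0)))).
    apply: ler_sum => k _; apply: le_trans (bound k).
    have wk : widen_ord (leqnSn N) k = inord k by apply: val_inj; rewrite /= inordK// ltnS ltnW.
    by rewrite wk.
  rewrite !big_split /= sumI -!mulr_sumr ZJ lerD2r lerD2l.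
  by rewrite ler_pM2l//; lra.
have NN : (N.-1 < N)%N by rewrite prednK.
have H2 : lam * (omega ord_max * phi.[xi ord_max] ^+ 2 / b.[xi ord_max]) <=
    12 * lam * (J (b * zeta ^+ 2) + 2 * eps) + 96 * E.
  have <- : x N = xi ord_max by rewrite -node_ord.
  rewrite phi_last; apply: le_trans (right_bound (ltW eps0) Vz) _.
  rewrite lerD2r ler_pM2l ?mulr_gt0//; apply: le_trans (Zle _ NN).
  by rewrite /Z prednK.
have le := mulr_gt0 lp eps0.
move: epse; rewrite -mulrA => epse.
lra.
Qed.

Hypothesis size_phi : (size phi <= N.+1)%N.

(** With [phi = b chi], the inverse inequality leads to the integral of [b chi^2], and quadrature to
    the sum of [phi^2 / b] over the nodes. *)
Lemma energy_phi : J (w * phi^`() ^+ 2) <= 1600 * E.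
Proof.
have l2 := lam_ge2 P_leg; have lp : 0 < lam by lra.
have [||chi phiE] := @jbubble_factor R al be al01 be01 phi.
- move=> al0; rewrite -xN phi_last hornerD hornerN xN U_right// /jacobi_proj hornerM.
  by rewrite b_right0// mul0r subrr.
- move=> be0; rewrite -x0 phi_V// hornerD hornerN x0 U_left// /jacobi_proj hornerM.
  by rewrite b_left0// mul0r subrr.
have schi : (size chi <= n)%N.
  have [->|chi0] := eqVneq chi 0; first by rewrite size_poly0.
  move: size_phi; rewrite phiE size_mul ?jbubble_neq0// size_jbubble//.
  by move: (size chi) (jdeg al be) => s m; lia.
rewrite phiE; apply: le_trans (inverse_inequality al01 be01 schi) _.
(* For [m <= N] the eigenvalue is [n N]. The remaining case is [N = 1], [m = 2], where [n = 0], its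
   truncated predecessor is 0, and the eigenvalue is 2. *)
have eig : jacobi_eigen R al be n.-1 <= lam.
  rewrite ler_nat; have := jdeg_le2; move: (jdeg al be) N_gt0 => m N0 m2.
  have [m1|m1] := leqP m N.
    have -> : ((N.+1 - m).-1 + m = N)%N by lia.
    by rewrite mulnC leq_mul//; lia.
  have -> : N = 1%N by lia.
  by have -> : m = 2 by lia.
have bchi0 : 0 <= J (b * chi ^+ 2).
  apply: pint_ge0 => [|t t1]; first by lra.
  by rewrite hornerM horner_exp mulr_ge0 ?sqr_ge0// b_ge0.
apply: le_trans (ler_wpM2r bchi0 eig) _.
apply: le_trans node_sum_bound; rewrite ler_pM2l//.
(* The degree of [b chi^2] is at most [2 N - m], so quadrature is exact unless [m = 0], where
   [b = 1] and [gl_quadrature_sqr] applies. *)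
have quad : J (b * chi ^+ 2) <= \sum_i omega i * (b * chi ^+ 2).[xi i].
  have [m0|m0] := posnP (jdeg al be).
    have b1 : b = 1.
      move: m0; rewrite /jdeg => m0.
      have [-> ->] : al = 1%N /\ be = 1%N.
        by move: al01 be01 m0; rewrite !inE => /orP[] /eqP -> /orP[] /eqP ->.
      by rewrite /jbubble subnn !expr0 mulr1.
    rewrite b1 mul1r; apply: le_trans (gl_quadrature_sqr P_leg x_inj xi_root _) _.
      by apply: leq_trans schi _; rewrite leq_subr.
    by apply: ler_sum => i _; rewrite horner_exp.
  rewrite (gl_quadrature P_leg x_inj xi_root)//.
  have [->|chi0] := eqVneq chi 0; first by rewrite expr0n mulr0 size_poly0.
  rewrite (leq_trans (size_polyMleq _ _))// size_jbubble//.
  have := size_polyMleq chi chi; rewrite -expr2.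
  have : (0 < size chi)%N by rewrite size_poly_gt0.
  move: schi m0 jdeg_le2; move: (size chi) (size (chi ^+ 2)) (jdeg al be) => s s2 m.
  by rewrite -addnn; lia.
apply: le_trans quad _; apply: ler_sum => i _.
rewrite -mulrA ler_wpM2l ?(ltW (gl_weight_gt0 P_leg x_inj xi_root i))//.
rewrite phiE !(hornerM b) horner_exp.
(* Where [b] vanishes both sides are 0, the right one by the convention on inverses. *)
have [->|bi] := eqVneq b.[xi i] 0; first by rewrite !mul0r invr0 mulr0.
by rewrite le_eqVlt; apply/orP; left; apply/eqP; field.
Qed.

End MainEstimate.

(** * Lebesgue integrals of piecewise polynomial functions *)

Section LebesgueIntegral.
Variable R : realType.
Local Notation mu := (@lebesgue_measure R).
Implicit Types (p : {poly R}) (f : R -> R).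

Lemma derive1_horner p t : derive1 (horner p) t = p^`().[t].
Proof. by rewrite derivE. Qed.

Lemma continuous_within_horner p (A : set R) : {within A, continuous (horner p)}%classic.
Proof. by apply: continuous_subspaceT => t; exact: continuous_horner. Qed.

Lemma integral_horner p (a b : R) : a < b ->
  (\int[mu]_(t in `[a, b]%classic) (p.[t])%:E = (pint a b p)%:E)%E.
Proof.
move=> ab; rewrite (@continuous_FTC2 _ _ (horner (primitive p)))//.
- exact: continuous_within_horner.
- split=> [t _||].
  + exact: derivable_horner.
  + by apply: cvg_at_right_filter; exact: continuous_horner.
  + by apply: cvg_at_left_filter; exact: continuous_horner.
- by move=> t _; rewrite derive1_horner deriv_primitive.
Qed.

(** Induction over half-open intervals, which makes the cells disjoint. Agreement on open cells
    suffices, since single points do not affect the integral. *)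
Lemma Rintegral_piecewise (N : nat) (x : nat -> R) (F : nat -> {poly R}) f :
  (forall k, (k < N)%N -> x k < x k.+1) ->
  (forall k t, (k < N)%N -> x k < t < x k.+1 -> f t = (F k).[t]) ->
  (forall t, x 0 <= t <= x N -> 0 <= f t) ->
  \int[mu]_(t in `[x 0, x N]%classic) f t = pw N x F.
Proof.
move=> x_lt fF f0.
have step n : (n <= N)%N -> measurable_fun `[x 0, x n[%classic f /\
    (\int[mu]_(t in `[x 0%N, x n[%classic) (f t)%:E = (pw n x F)%:E)%E.
  elim: n => [|n IH] nN.
    rewrite set_itvco0; split; first exact: measurable_fun_set0.
    by rewrite integral_set0 /pw big_ord0.
  have [mf If] := IH (ltnW nN); have xn := x_lt n nN.
  have x0n : x 0 <= x n by apply: (node_le x_lt); rewrite (ltnW nN).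
  have xnN : x n.+1 <= x N by apply: (node_le x_lt); rewrite nN leqnn.
  have eqF : {in `]x n, x n.+1[%classic, horner (F n) =1 f}.
    by move=> t; rewrite inE /= in_itv /= => tn; rewrite (fF n).
  have mo : measurable_fun `]x n, x n.+1[%classic f.
    by apply: (eq_measurable_fun (horner (F n))) => //; exact: measurable_poly.
  have mc : measurable_fun `[x n, x n.+1[%classic f.
    exact/measurable_fun_itv_obnd_cbndP.
  have setE : `[x 0, x n.+1[%classic = (`[x 0, x n[ `|` `[x n, x n.+1[)%classic.
    by apply: itv_bndbnd_setU; rewrite bnd_simp// ltW.
  split; first by rewrite setE measurable_funU.
  rewrite setE ge0_integral_setU//=; last first.
  - by apply/disj_setPS => t [/=]; rewrite !in_itv /= => /andP[_ ?] /andP[]; lra.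
  - by move=> t; rewrite !in_itv /= => -[] /andP[t0 t1]; rewrite lee_fin f0//; lra.
  - by rewrite -setE; apply/measurable_EFinP; rewrite setE measurable_funU.
  rewrite If /pw big_ord_recr /= EFinD; congr (_ + _)%E.
  rewrite -integral_itv_obnd_cbnd; last exact/measurable_EFinP.
  rewrite -integral_horner//.
  rewrite -[RHS]integral_itv_bndo_bndc; last first.
    by apply/measurable_EFinP; exact: measurable_poly.
  rewrite -[RHS]integral_itv_obnd_cbnd; last first.
    by apply/measurable_EFinP; exact: measurable_poly.
  by apply: eq_integral => t tn; rewrite eqF.
have [mf If] := step N (leqnn N).
rewrite /Rintegral -integral_itv_bndo_bndc ?If//.
exact/measurable_EFinP.
Qed.

End LebesgueIntegral.

Lemma weighted_H1_seminorm_horner (R : realType) (al be : nat) (p : {poly R}) :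
  weighted_H1_seminorm al be (horner p) =
  Num.sqrt (pint (-1) 1 (jweight R al be * p^`() ^+ 2)).
Proof.
rewrite /weighted_H1_seminorm /weighted_norm /Rintegral; congr (Num.sqrt _).
rewrite -[RHS]/(fine (pint (-1) 1 (jweight R al be * p^`() ^+ 2))%:E).
rewrite -integral_horner; last by lra.
congr fine; apply: eq_integral => t _; congr (_%:E).
by rewrite derive1_horner hornerM horner_exp horner_jweight -mulrA mulrC.
Qed.

(** * Piecewise linear functions as families of polynomials *)

Section PiecewiseLinear.
Variables (R : realType) (N : nat) (xi : 'I_N.+1 -> R) (u : R -> R).
Hypotheses (xi_first : xi ord0 = -1) (xi_last : xi ord_max = 1).
Hypothesis xi_lt : forall i j : 'I_N.+1, (i < j)%N -> xi i < xi j.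
Hypothesis u_affine : forall i j : 'I_N.+1, j = i.+1 :> nat ->
  exists a b : R, forall t : R, xi i <= t <= xi j -> u t = a * t + b.
Local Notation x := (node xi).

Let x_lt k : (k < N)%N -> x k < x k.+1. Proof. exact: node_lt. Qed.

Definition slope k : R := (u (x k.+1) - u (x k)) / (x k.+1 - x k).

Definition piece k : {poly R} := (u (x k))%:P + slope k *: ('X - (x k)%:P).

Lemma deriv_piece k : (piece k)^`() = (slope k)%:P.
Proof. by rewrite /piece derivD derivC add0r derivZ derivXsubC alg_polyC. Qed.

Lemma horner_piece k t : (k < N)%N -> x k <= t <= x k.+1 -> (piece k).[t] = u t.
Proof.
move=> kN tk; have xk := x_lt kN.
have [|a [b uE]] := @u_affine (inord k) (inord k.+1).
  by rewrite !inordK// ltnS// ltnW.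
rewrite -!/(node xi _) in uE.
rewrite /piece !hornE /slope !uE; [|lra..].
by field; lra.
Qed.

(** The sum of all slopes in absolute value is a crude constant depending on [u] and [N]; it only
    serves for density and does not enter the stability constant. *)
Lemma u_lipschitz : exists2 L : R, 0 <= L & forall s t : R,
  -1 <= s <= 1 -> -1 <= t <= 1 -> `|u s - u t| <= L * `|s - t|.
Proof.
pose L := \sum_(k < N) `|slope k|.
have L0 : 0 <= L by apply: sumr_ge0.
exists L => //; rewrite -(node_first xi_first) -(node_last xi_last).
suff step n : (n <= N)%N -> forall s t : R,
    x 0 <= s <= x n -> x 0 <= t <= x n -> `|u s - u t| <= L * `|s - t| by exact: step.
elim: n => [|n IH] nN s t sx tx.
  have -> : s = t by move: sx tx => /andP[? ?] /andP[? ?]; lra.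
  by rewrite !subrr !normr0 mulr0.
have {}IH := IH (ltnW nN).
have x0n : x 0 <= x n by apply: (node_le x_lt); rewrite (ltnW nN).
wlog st : s t sx tx / s <= t.
  move=> H; have [/H|/ltW /H] := leP s t; first exact.
  by rewrite (distrC (u t)) (distrC t); exact.
have last a b : x n <= a <= x n.+1 -> x n <= b <= x n.+1 -> `|u a - u b| <= L * `|a - b|.
  move=> an bn; rewrite -(horner_piece nN an) -(horner_piece nN bn) /piece !hornE.
  have -> : u (x n) + slope n * (a - x n) - (u (x n) + slope n * (b - x n)) =
     slope n * (a - b) by ring.
  rewrite normrM ler_wpM2r// /L (bigD1 (Ordinal nN)) //= lerDl.
  exact: sumr_ge0.
move: sx tx => /andP[s0 s1] /andP[t0 t1].
have [tn|tn] := leP t (x n); first by apply: IH; rewrite ?s0 ?t0// (le_trans st).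
have [sn|sn] := leP (x n) s; first by apply: last; rewrite ?sn ?s1 ?t1 ?(ltW tn).
have h1 : `|u s - u (x n)| <= L * `|s - x n| by apply: IH; lra.
have h2 : `|u (x n) - u t| <= L * `|x n - t|.
  by have xn := x_lt nN; apply: last; lra.
apply: le_trans (ler_distD (u (x n)) _ _) (le_trans (lerD h1 h2) _).
rewrite -mulrDr !ler0_norm; [|lra..].
by rewrite ler_wpM2l//; lra.
Qed.

Lemma weighted_H1_seminorm_piecewise (al be : nat) :
  weighted_H1_seminorm al be u = Num.sqrt (energy al be N x piece).
Proof.
rewrite /weighted_H1_seminorm /weighted_norm; congr (Num.sqrt _).
rewrite -{2}(node_last xi_last) -{1}(node_first xi_first).
apply: (Rintegral_piecewise x_lt) => [k t kN tk|t].
  rewrite hornerM horner_exp horner_jweight deriv_piece hornerC -mulrA mulrC.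
  congr (_ * _ ^+ 2).
  have -> : derive1 u t = derive1 (horner (piece k)) t.
    rewrite !derive1E; apply: near_eq_derive.
    have : t \in `]x k, x k.+1[ by rewrite in_itv.
    move=> /near_in_itvoo; apply: filterS => y; rewrite in_itv /= => /andP[y1 y2].
    by rewrite horner_piece// !ltW.
  by rewrite derive1_horner deriv_piece hornerC.
rewrite (node_first xi_first) (node_last xi_last) => t1.
by apply: mulr_ge0; [apply: mulr_ge0; [exact: sqr_ge0|]|]; apply: exprn_ge0; lra.
Qed.

End PiecewiseLinear.

(** * Stability *)

Section Stability.
Variables (R : realType) (al be : nat).
Hypotheses (al01 : al \in [:: 0; 1]%N) (be01 : be \in [:: 0; 1]%N).
Variables (N : nat) (xi : 'I_N.+1 -> R) (u : R -> R).
Hypotheses (N_gt0 : (0 < N)%N) (xi_gl : gauss_lobatto xi).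
Hypothesis u_affine : forall i j : 'I_N.+1, j = i.+1 :> nat ->
  exists a b : R, forall t : R, xi i <= t <= xi j -> u t = a * t + b.
Local Notation x := (node xi).
Local Notation W := (piece xi u).
Local Notation w := (jweight R al be).
Local Notation b := (jbubble R al be).
Local Notation J := (pint (-1) 1).
Local Notation E := (energy al be N x W).

Let xi_first : xi ord0 = -1. Proof. by case: xi_gl. Qed.
Let xi_last : xi ord_max = 1. Proof. by case: xi_gl. Qed.
Let xi_lt (i j : 'I_N.+1) : (i < j)%N -> xi i < xi j.
Proof. by case: xi_gl => _ _; move=> /(_ i j). Qed.
Let x_lt k : (k < N)%N -> x k < x k.+1. Proof. exact: node_lt. Qed.
Let x0 : x 0 = -1. Proof. exact: node_first. Qed.
Let xN : x N = 1. Proof. exact: node_last. Qed.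
Let WE k t : (k < N)%N -> x k <= t <= x k.+1 -> (W k).[t] = u t.
Proof. exact: horner_piece. Qed.

Let cell_left k : (k < N)%N -> x k <= x k <= x k.+1.
Proof. by move=> kN; rewrite lexx ltW// x_lt. Qed.
Let cell_right k : (k < N)%N -> x k <= x k.+1 <= x k.+1.
Proof. by move=> kN; rewrite lexx ltW// x_lt. Qed.

Let E_ge0 : 0 <= E.
Proof.
apply: (pw_ge0 x_lt) => k t kN tk; rewrite hornerM horner_exp mulr_ge0 ?sqr_ge0//.
apply: jweight_ge0; have /andP[t0 t1] := tk.
have := node_le x_lt (_ : (0 <= k <= N)%N); rewrite (ltnW kN) x0 => /(_ isT) k0.
have := node_le x_lt (_ : (k.+1 <= N <= N)%N); rewrite kN leqnn xN => /(_ isT) k1.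
lra.
Qed.

(** If both ends impose a condition, the chord is taken: its slope is the mean of [u'], and
    expanding the integral of [(u' - s)^2] bounds its energy. Otherwise a constant suffices. *)
Lemma linear_correction : exists s c : R,
  [/\ al = 0%N -> s * 1 + c = u 1, be = 0%N -> s * -1 + c = u (-1)
    & J (w * (s%:P) ^+ 2) <= E].
Proof.
have J0 : J (w * (0%:P) ^+ 2) <= E by rewrite expr0n mulr0 linear0.
move: al01 be01; rewrite !inE => /orP[] /eqP al_ /orP[] /eqP be_.
- exists ((u 1 - u (-1)) / 2), ((u 1 + u (-1)) / 2).
  split; [by move=> _; field|by move=> _; field|].
  set s := _ / 2; have w1 : w = 1 by rewrite /jweight al_ be_ !expr0 mulr1.
  have I1 : pw N x (fun k => (W k)^`()) = 2 * s.
    rewrite (@pw_deriv R N x W)//; last first.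
      by move=> k kN; rewrite !WE ?cell_left ?cell_right// ltnW.
    have NN : (N.-1 < N)%N by rewrite prednK.
    have tN : x N.-1 <= x N <= x N.-1.+1.
      by have := cell_right NN; rewrite prednK.
    by rewrite (WE NN tN) (WE N_gt0 (cell_left N_gt0)) x0 xN /s; field.
  have : 0 <= pw N x (fun k => ((W k)^`() - s%:P) ^+ 2).
    by apply: (pw_ge0 x_lt) => k t _ _; rewrite horner_exp sqr_ge0.
  have -> : pw N x (fun k => ((W k)^`() - s%:P) ^+ 2) =
      E - (2 * s) * pw N x (fun k => (W k)^`()) + pw N x (fun=> (s ^+ 2)%:P).
    rewrite -pwZ -pwB -pwD; apply: eq_pw => k _.
    by rewrite w1 mul1r -mul_polyC !(polyCM, polyC_exp, polyCMn); ring.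
  rewrite pw_poly x0 xN w1 mul1r -polyC_exp !pintC I1; lra.
- exists 0, (u 1); split=> // [_|]; first by rewrite mul0r add0r.
  by rewrite be_.
- exists 0, (u (-1)); split=> // [|_]; first by rewrite al_.
  by rewrite mul0r add0r.
- by exists 0, 0; split=> //; rewrite ?al_ ?be_.
Qed.

(** The interpolant is [phi + z + lin]: the correction [lin] makes [u - lin] vanish at the zeros of
    [b], [z] is its projection and [phi] interpolates the error. *)
Lemma interpolant_energy :
  J (w * (lagrange_interp xi u)^`() ^+ 2) <= 200 ^+ 2 * E.
Proof.
have [s [c [u1 um1 sE]]] := linear_correction.
pose lin : {poly R} := s *: 'X + c%:P.
have linE t : lin.[t] = s * t + c by rewrite /lin !hornE.
have dlin : lin^`() = s%:P.
  by rewrite /lin derivD derivC addr0 derivZ derivX alg_polyC.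
pose U k := W k - lin.
pose u0 t := u t - lin.[t].
have UE k t : (k < N)%N -> x k <= t <= x k.+1 -> (U k).[t] = u0 t.
  by move=> kN tk; rewrite /U /u0 hornerD hornerN WE.
have NN : (N.-1 < N)%N by rewrite prednK.
have tN : x N.-1 <= x N <= x N.-1.+1 by have := cell_right NN; rewrite prednK.
have U_deriv k : (k < N)%N -> (U k)^`() = (slope xi u k - s)%:P.
  by move=> kN; rewrite /U derivB deriv_piece dlin polyCB.
have U_cont k : (k.+1 < N)%N -> (U k).[x k.+1] = (U k.+1).[x k.+1].
  by move=> kN; rewrite !UE ?cell_left ?cell_right// ltnW.
have U_right : al = 0%N -> (U N.-1).[1] = 0.
  by move=> al0; rewrite -xN UE// xN /u0 linE u1// subrr.
have U_left : be = 0%N -> (U 0%N).[-1] = 0.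
  by move=> be0; rewrite -x0 UE ?cell_left// x0 /u0 linE um1// subrr.
have U_dense (eps : R) : 0 < eps -> exists chi : {poly R},
    forall k t, (k < N)%N -> x k <= t <= x k.+1 ->
    ((U k).[t] - b.[t] * chi.[t]) ^+ 2 <= eps * b.[t].
  move=> eps0; have [L L0 uL] := u_lipschitz xi_first xi_last xi_lt u_affine.
  have u0L (a a' : R) : -1 <= a <= 1 -> -1 <= a' <= 1 ->
      (u0 a - u0 a') ^+ 2 <= (L + `|s|) ^+ 2 * (a - a') ^+ 2.
    move=> a1 a2; rewrite -exprMn -real_normK ?num_real//.
    rewrite -[leRHS]real_normK ?num_real// ler_sqr ?nnegrE//.
    rewrite [leRHS]normrM (ger0_norm (addr_ge0 L0 (normr_ge0 s))).
    have -> : u0 a - u0 a' = (u a - u a') + - (s * (a - a')) by rewrite /u0 !linE; ring.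
    apply: le_trans (ler_normD _ _) _; rewrite normrN normrM mulrDl.
    by rewrite lerD2r uL.
  have [||chi chiE] := jbubble_density al01 be01 u0L _ _ eps0.
  - by move=> al0; rewrite /u0 linE u1// subrr.
  - by move=> be0; rewrite /u0 linE um1// subrr.
  exists chi => k t kN tk; rewrite UE// chiE//.
  have /andP[t0 t1] := tk.
  have := node_le x_lt (_ : (0 <= k <= N)%N); rewrite (ltnW kN) x0 => /(_ isT) k0.
  have := node_le x_lt (_ : (k.+1 <= N <= N)%N); rewrite kN leqnn xN => /(_ isT) k1.
  lra.
pose P := legendre R N.
have P_leg : legendre_like N P := legendre_like_legendre R N_gt0.
have xi_root i : ((1 - 'X ^+ 2) * P^`()).[xi i] = 0.
  by have [_ _ _ r] := xi_gl; apply/rootP/r; exists i.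
pose z := jacobi_proj al be N x U (N.+1 - jdeg al be).
pose phi := lagrange_interp xi u0 - z.
have xi_inj : injective xi := xi_inj xi_lt.
have phiE k : (k <= N)%N -> phi.[x k] = u0 (x k) - z.[x k].
  by move=> kN; rewrite /phi hornerD hornerN /node lagrange_interp_node.
have phi_V k : (k < N)%N -> phi.[x k] = (U k - z).[x k].
  by move=> kN; rewrite phiE ?(ltnW kN)// hornerD hornerN UE// cell_left.
have phi_last : phi.[x N] = (U N.-1 - z).[x N].
  by rewrite phiE// hornerD hornerN UE.
have size_phi : (size phi <= N.+1)%N.
  rewrite (leq_trans (size_polyD _ _))// geq_max size_lagrange_interp size_polyN /=.
  rewrite (leq_trans (size_proj al01 be01 _ _ _ _))// subnKC//.
  by rewrite (@leq_trans 2)// /jdeg; lia.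
have Ephi := energy_phi al01 be01 P_leg xi_first xi_last xi_lt xi_root U_deriv
  U_cont U_right U_left U_dense phi_V phi_last size_phi.
have Ez : J (w * z^`() ^+ 2) <= energy al be N x U.
  exact: (energy_proj_le al01 be01 N_gt0 x_lt x0 xN U_cont U_right U_left).
have w0 (t : R) : -1 <= t <= 1 -> 0 <= w.[t] by exact: jweight_ge0.
have EU : energy al be N x U <= 4 * E.
  apply: (@le_trans _ _ (pw N x (fun k => 2 *: (w * (W k)^`() ^+ 2) + 2 *: (w * s%:P ^+ 2)))).
    apply: (le_pw x_lt) => k t kN tk.
    rewrite /U derivB dlin hornerD !hornerZ !(hornerM w) !horner_exp hornerD hornerN hornerC.
    have t1 : -1 <= t <= 1.
      have /andP[t0 t1] := tk.
      have := node_le x_lt (_ : (0 <= k <= N)%N); rewrite (ltnW kN) x0 => /(_ isT) k0.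
      have := node_le x_lt (_ : (k.+1 <= N <= N)%N); rewrite kN leqnn xN => /(_ isT) k1.
      lra.
    have := mulr_ge0 (w0 t t1) (sqr_ge0 ((W k)^`().[t] + s)); lra.
  rewrite pwD !pwZ pw_poly x0 xN; move: sE; rewrite /energy; lra.
have pE : lagrange_interp xi u = phi + z + lin.
  rewrite /phi subrK; apply/esym/lagrange_interp_unique => // [|i].
    rewrite (leq_trans (size_polyD _ _))// geq_max size_lagrange_interp.
    rewrite (leq_trans (size_polyD _ _))// geq_max.
    rewrite (leq_trans (size_scale_leq _ _)) ?size_polyX ?ltnS//.
    by rewrite (leq_trans (size_polyC_leq1 _)).
  by rewrite hornerD lagrange_interp_node// /u0 subrK.
have -> : (lagrange_interp xi u)^`() = phi^`() + z^`() + s%:P.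
  by rewrite pE (derivD (phi + z)) (derivD phi) dlin.
(* The three energies are at most [6400 E], [4 E] and [E]; three times their sum is below
   [200^2 E]. *)
apply: (@le_trans _ _ (3 * J (w * phi^`() ^+ 2) + 3 * J (w * z^`() ^+ 2) +
    3 * J (w * s%:P ^+ 2))).
  rewrite -!pintZ -!pintD le_pint// => t t1.
  rewrite !hornerD !hornerZ !(hornerM w) !horner_exp !hornerD hornerC.
  set A := phi^`().[t]; set B := z^`().[t].
  have D0 : 0 <= (A - B) ^+ 2 + (A - s) ^+ 2 + (B - s) ^+ 2.
    by rewrite !addr_ge0 ?sqr_ge0.
  by have := mulr_ge0 (w0 t t1) D0; lra.
move: Ephi Ez EU sE E_ge0.
move: (J (w * phi^`() ^+ 2)) (J (w * z^`() ^+ 2)) (J (w * s%:P ^+ 2)) => a1 a2 a3.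
move: (energy al be N x U) E => e1 e2.
lra.
Qed.

End Stability.

Theorem theorem4 (R : realType) (alpha beta : nat)
  (halpha : alpha \in [:: 0; 1]%N) (hbeta : beta \in [:: 0; 1]%N) :
  exists2 C : R, 0 < C &
    forall (N : nat) (xi : 'I_N.+1 -> R) (u : R -> R),
      (1 <= N)%N -> gauss_lobatto xi -> piecewise_linear xi u ->
      weighted_H1_seminorm alpha beta (horner (lagrange_interp xi u))
        <= C * weighted_H1_seminorm alpha beta u.
Proof.
exists 200 => // N xi u N1 xi_gl [_ u_affine].
have [xi_first xi_last xi_lt _] := xi_gl.
rewrite weighted_H1_seminorm_horner (weighted_H1_seminorm_piecewise xi_first xi_last)//.
have -> : (200 : R) = Num.sqrt (200 ^+ 2) by rewrite sqrtr_sqr ger0_norm.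
rewrite -sqrtrM ?exprn_ge0// ler_wsqrtr//.
exact: interpolant_energy.
Qed.
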